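(* Let $\zeta\in X^1(\mathbb Z)$. For any $p\ge1$, the Cauchy problem for the modified gAL equation $$i\frac{d\phi_n}{dt}+\kappa(\Delta(\phi+\zeta))_n-\mu q_0^{2p}(\phi_n+\zeta_n)+\tfrac12\mu|\phi_n+\zeta_n|^{2p}(\phi_{n+1}+\zeta_{n+1}+\phi_{n-1}+\zeta_{n-1})=0,\quad n\in\mathbb Z,$$ with initial condition $\phi(0)=(\phi_n(0))_{n\in\mathbb Z}\in\ell^2$ and $\lim_{|n|\to\infty}\phi_n(t)=0$, $t\ge0$, possesses a unique solution $\phi\in\overline{B(0,\varrho)}\subset C([0,T];\ell^2)$, where $B(0,\varrho)$ denotes the open ball centered at the origin with radius $$\varrho=\varrho(T)=2\Big[\|\phi(0)\|_{\ell^2}+\sqrt{2\kappa}\,\|\zeta'\|_{\ell^2}\sqrt T+|\mu|\Big(2^{2(p+2)}p\big(\|\zeta\|_{\ell^\infty}+q_0+\||\zeta|-q_0\|_{\ell^2}\big)^{2p+1}+q_0^{2p}\|\zeta''\|_{\ell^2}\Big)T\Big],$$ and the lifespan $T>0$ satisfies $$2^{\frac72}|\mu|\Big[q_0^{2p}+2^{2p+\frac12}(2p+1)\big(\varrho(T)+\|\zeta\|_{\ell^\infty}\big)^{2p}\Big]T\le1.$$ Furthermore, the solution depends continuously on the initial data.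
   Context: $\ell^r=\ell^r(\mathbb Z)$ are spaces of complex sequences; $(\Delta u)_n:=u_{n+1}+u_{n-1}-2u_n$; $\kappa>0$, $\mu\in\mathbb R$; $\zeta'_n:=\zeta_n-\zeta_{n-1}$; $\zeta''_n:=\zeta'_n-\zeta'_{n-1}$; $X^1(\mathbb Z):=\{\zeta\in\ell^\infty:\zeta'\in\ell^2\}$ (so that $\zeta\in X^1(\mathbb Z)$ implies $\zeta''\in\ell^2$, since $\|\zeta''\|_{\ell^2}\le2\|\zeta'\|_{\ell^2}$); $|\zeta|-q_0$ denotes the sequence $(|\zeta_n|-q_0)_{n\in\mathbb Z}$. The background satisfies $\lim_{n\to\pm\infty}\zeta_n=\zeta_\pm\in\mathbb C$ with $|\zeta_\pm|=q_0>0$. $C([0,T];\ell^2)$ carries the norm $\sup_{t\in[0,T]}\|\cdot\|_{\ell^2}$. The equation arises from $i\frac{du_n}{dt}+\kappa(\Delta u)_n+\frac12\mu|u_n|^{2p}(u_{n+1}+u_{n-1})=0$ through $u_n(t)=e^{i\mu q_0^{2p}t}(\phi_n(t)+\zeta_n)$, so that $\phi_n(0)=u_n(0)-\zeta_n$. A solution is understood as a solution of the corresponding time-integrated (Duhamel) equation. *)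

(* Defs.v *)
From Stdlib Require Import Reals ZArith Factorial.
From Coquelicot Require Import Coquelicot.

Open Scope R_scope.

(** ** Sequence spaces on the integers *)

(** Folded as [f 0 + f (-1)] + [f 1 + f (-2)] + ...; only used for [0 <= f],
    where the order of summation is immaterial. *)
Definition fold_Z (f : Z -> R) (k : nat) : R :=
  f (Z.of_nat k) + f (- Z.of_nat k - 1)%Z.

Definition in_l2 (u : Z -> C) : Prop :=
  ex_series (fold_Z (fun n => Cmod (u n) ^ 2)).

(** Meaningful under [in_l2 u]: [Series] is a total function. *)
Definition l2_norm (u : Z -> C) : R :=
  sqrt (Series (fold_Z (fun n => Cmod (u n) ^ 2))).

Definition in_linf (u : Z -> C) : Prop :=
  exists M : R, forall n : Z, Cmod (u n) <= M.

(** Meaningful under [in_linf u]. *)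
Definition linf_norm (u : Z -> C) : R :=
  real (Lub_Rbar (fun x => exists n : Z, x = Cmod (u n))).

Definition seq_minus (u v : Z -> C) (n : Z) : C := (u n - v n)%C.

(** Backward difference [u'_n = u_n - u_(n-1)]. *)
Definition diff (u : Z -> C) (n : Z) : C := (u n - u (n - 1)%Z)%C.

Definition Delta (u : Z -> C) (n : Z) : C :=
  (u (n + 1)%Z + u (n - 1)%Z - RtoC 2 * u n)%C.

Definition in_X1 (zeta : Z -> C) : Prop := in_linf zeta /\ in_l2 (diff zeta).

Definition lim_at_infty (u : Z -> C) (lm lp : C) : Prop :=
  filterlim (fun k : nat => u (- Z.of_nat k)%Z) eventually (locally lm) /\
  filterlim (fun k : nat => u (Z.of_nat k)) eventually (locally lp).

(** ** The space C([0,T]; l^2) *)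

Definition in_CT (T : R) (phi : R -> Z -> C) : Prop :=
  (forall t, 0 <= t <= T -> in_l2 (phi t)) /\
  (forall t, 0 <= t <= T ->
     filterlim (fun s => l2_norm (seq_minus (phi s) (phi t)))
       (within (fun s => 0 <= s <= T) (locally t)) (locally 0)).

Definition CT_norm (T : R) (phi : R -> Z -> C) : Rbar :=
  Lub_Rbar (fun x => exists t, 0 <= t <= T /\ x = l2_norm (phi t)).

Definition CT_minus (phi psi : R -> Z -> C) (t : R) : Z -> C :=
  seq_minus (phi t) (psi t).

(** [CT_norm] takes values in [Rbar], so that the inequality also asserts
    finiteness. *)
Definition in_closed_ball (T rho : R) (phi : R -> Z -> C) : Prop :=
  in_CT T phi /\ Rbar_le (CT_norm T phi) rho.

(** ** The equation *)

(** [x ^ a] for [0 <= x] and [0 < a]. The case split is needed because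
    [Rpower 0 a = 1], as [ln 0 = 0]. *)
Definition rpow (x a : R) : R :=
  if Req_EM_T x 0 then 0 else Rpower x a.

Definition CSeries (a : nat -> C) : C :=
  (Series (fun k => Re (a k)), Series (fun k => Im (a k))).

(** The propagator [exp (i kappa t Delta)] of [i du/dt + kappa Delta u = 0], as
    the exponential series of the bounded operator [Delta], whose norm on
    bounded sequences is at most 4. *)
Definition propagator (kappa t : R) (u : Z -> C) (n : Z) : C :=
  CSeries (fun k : nat =>
    (Cpow (Ci * RtoC (kappa * t)) k / RtoC (INR (fact k))
       * Nat.iter k Delta u n)%C).

(** With this notation the modified gAL equation reads
    [i dphi/dt + kappa Delta phi + forcing phi = 0]. *)
Definition forcing (kappa mu q0 p : R) (zeta v : Z -> C) (n : Z) : C :=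
  (RtoC kappa * Delta zeta n
   - RtoC (mu * rpow q0 (2 * p)) * (v n + zeta n)
   + RtoC (/ 2 * mu * rpow (Cmod (v n + zeta n)) (2 * p))
     * (v (n + 1)%Z + zeta (n + 1)%Z + v (n - 1)%Z + zeta (n - 1)%Z))%C.

(** Duhamel form
    [phi(t) = e^{i kappa t Delta} phi(0)
       + i int_0^t e^{i kappa (t-s) Delta} forcing(phi(s)) ds],
    with the integral taken at each lattice site. *)
Definition duhamel (kappa mu q0 p : R) (zeta phi0 : Z -> C) (T : R)
    (phi : R -> Z -> C) : Prop :=
  forall (t : R) (n : Z), 0 <= t <= T ->
    exists I : C,
      is_RInt (V := C_R_NormedModule)
        (fun s => propagator kappa (t - s) (forcing kappa mu q0 p zeta (phi s)) n)
        0 t I /\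
      phi t n = (propagator kappa t phi0 n + Ci * I)%C.

Definition solves_Cauchy (kappa mu q0 p : R) (zeta phi0 : Z -> C) (T : R)
    (phi : R -> Z -> C) : Prop :=
  duhamel kappa mu q0 p zeta phi0 T phi /\
  (forall n, phi 0 n = phi0 n) /\
  (forall t, 0 <= t <= T -> lim_at_infty (phi t) (RtoC 0) (RtoC 0)).

(** ** Radius and lifespan *)

Definition abs_defect (q0 : R) (zeta : Z -> C) (n : Z) : C :=
  RtoC (Cmod (zeta n) - q0).

Definition rho (kappa mu q0 p : R) (zeta phi0 : Z -> C) (T : R) : R :=
  2 * (l2_norm phi0
       + sqrt (2 * kappa) * l2_norm (diff zeta) * sqrt T
       + Rabs mu
         * (rpow 2 (2 * (p + 2)) * p
              * rpow (linf_norm zeta + q0 + l2_norm (abs_defect q0 zeta)) (2 * p + 1)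
            + rpow q0 (2 * p) * l2_norm (diff (diff zeta)))
         * T).

Definition lifespan_condition (kappa mu q0 p : R) (zeta phi0 : Z -> C) (T : R)
    : Prop :=
  rpow 2 (7 / 2) * Rabs mu
  * (rpow q0 (2 * p)
     + rpow 2 (2 * p + 1 / 2) * (2 * p + 1)
       * rpow (rho kappa mu q0 p zeta phi0 T + linf_norm zeta) (2 * p))
  * T <= 1.

Definition ball_solution (kappa mu q0 p : R) (zeta phi0 : Z -> C) (T : R)
    (phi : R -> Z -> C) : Prop :=
  in_closed_ball T (rho kappa mu q0 p zeta phi0 T) phi /\
  solves_Cauchy kappa mu q0 p zeta phi0 T phi.

(* Main.v *)
Require Import Defs.
From Stdlib Require Import Reals ZArith Lra Lia List FunctionalExtensionality.
From Stdlib Require FinFun.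
From Coquelicot Require Import Coquelicot.
(* Again, because [Reals] declares its own [Delta]. *)
Import Defs.

(** With [U(t) = exp(i kappa t Delta)], Duhamel's map is
    [phi |-> U(t) phi0 + (U(t) zeta - zeta) + i int_0^t U(t-s) G(phi(s)) ds], where [G] is
    the gauged nonlinearity; the term [U(t) zeta - zeta] comes from integrating
    [kappa Delta zeta] exactly.  Since [d/dt ||U(t) zeta - zeta||^2 = 2 kappa Im <zeta', U(t) zeta'>],
    its l^2 norm is at most [sqrt (2 kappa t) ||zeta'||], and the same energy identity shows
    that [U(t)] is an l^2 contraction.  As [G] is Lipschitz on the ball of radius [rho], with a
    constant [L] such that [L T <= 1/2], the map preserves the ball and halves distances.  The
    iterates are uniformly Lipschitz in time, so their pointwise limit is a continuous
    l^2-valued path.  Halving of distances also gives uniqueness and Lipschitz dependence on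
    the data. *)

(** * Finite-sum bounds for the l^2 norm *)

(** The propagator is given only as a power series at each site, and Duhamel's integral is taken
    site by site, so neither a group law, nor unitarity, nor an l^2-valued integral is at hand.
    Every l^2 statement is therefore reduced to bounds on sums over finite sets of sites, uniform in
    the set. Such bounds survive sitewise limits and sitewise integration, and this replaces
    completeness of C([0,T]; l^2).

    The background is not in l^2, only its differences are. Hence the algebra and calculus of the
    propagator are developed for bounded sequences, and l^2 enters through [diff]. Estimating the
    integral of kappa Delta zeta in norm would cost kappa ||zeta''|| T, a term absent from the
    radius; exact integration followed by the energy estimate produces the term with sqrt T that
    stands there.

    The time regularity known for the Picard iterates is not known for an arbitrary solution in the
    ball. The difference estimates behind uniqueness are thus stated for integrands that are merely
    integrable at each site. *)

Definition site_sum (f : Z -> R) (l : list Z) : R := fold_right Rplus 0 (map f l).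

Lemma site_sum_cons f a l : site_sum f (a :: l) = f a + site_sum f l.
Proof. reflexivity. Qed.

Lemma site_sum_app f l l' : site_sum f (l ++ l') = site_sum f l + site_sum f l'.
Proof.
  induction l as [|a l IH]; [unfold site_sum; simpl; lra|].
  simpl app. rewrite !site_sum_cons, IH. lra.
Qed.

Lemma site_sum_le f g l :
  (forall n, In n l -> f n <= g n) -> site_sum f l <= site_sum g l.
Proof.
  induction l as [|a l IH]; intros H; [unfold site_sum; simpl; lra|].
  rewrite !site_sum_cons.
  pose proof (H a (or_introl eq_refl)).
  assert (site_sum f l <= site_sum g l) by (apply IH; intros; apply H; now right).
  lra.
Qed.

Lemma site_sum_ext f g l :
  (forall n, In n l -> f n = g n) -> site_sum f l = site_sum g l.
Proof.
  intros H; apply Rle_antisym; apply site_sum_le; intros n Hn;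
    rewrite (H n Hn); lra.
Qed.

Lemma site_sum_nonneg f l : (forall n, 0 <= f n) -> 0 <= site_sum f l.
Proof.
  intros H; induction l as [|a l IH]; [unfold site_sum; simpl; lra|].
  rewrite site_sum_cons. specialize (H a). lra.
Qed.

Lemma site_sum_plus f g l :
  site_sum (fun n => f n + g n) l = site_sum f l + site_sum g l.
Proof.
  induction l as [|a l IH]; [unfold site_sum; simpl; lra|].
  rewrite !site_sum_cons, IH; lra.
Qed.

Lemma site_sum_scal c f l : site_sum (fun n => c * f n) l = c * site_sum f l.
Proof.
  induction l as [|a l IH]; [unfold site_sum; simpl; lra|].
  rewrite !site_sum_cons, IH; lra.
Qed.

(** Each site of [l] is matched with one occurrence in [l'], and nonnegativity lets the leftover
    terms be dropped; [NoDup l] prevents an occurrence from being used twice. *)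
Lemma site_sum_incl f l l' :
  (forall n, 0 <= f n) -> NoDup l -> incl l l' -> site_sum f l <= site_sum f l'.
Proof.
  intros Hf Hl; revert l'.
  induction Hl as [|a l Ha Hl IH]; intros l' Hi.
  - apply (site_sum_nonneg f l' Hf).
  - destruct (in_split a l' (Hi a (or_introl eq_refl))) as (l1 & l2 & ->).
    assert (site_sum f l <= site_sum f (l1 ++ l2)).
    { apply IH. intros n Hn.
      pose proof (Hi n (or_intror Hn)) as Hin.
      apply in_app_or in Hin. apply in_or_app.
      destruct Hin as [Hin|[Hin|Hin]]; [now left|subst; contradiction|now right]. }
    rewrite site_sum_app in *. rewrite !site_sum_cons. lra.
Qed.

(** By induction: the new site and the old sums form the plane vectors (f a, sqrt A) and (g a, sqrt
    B), so only the planar inequality is left. *)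
Lemma site_sum_Cauchy_Schwarz f g l :
  site_sum (fun n => f n * g n) l
    <= sqrt (site_sum (fun n => f n ^ 2) l) * sqrt (site_sum (fun n => g n ^ 2) l).
Proof.
  induction l as [|a l IH].
  - unfold site_sum; simpl. rewrite sqrt_0; lra.
  - rewrite !site_sum_cons.
    assert (HA : 0 <= site_sum (fun n => f n ^ 2) l)
      by (apply site_sum_nonneg; intros; apply pow2_ge_0).
    assert (HB : 0 <= site_sum (fun n => g n ^ 2) l)
      by (apply site_sum_nonneg; intros; apply pow2_ge_0).
    set (A := site_sum (fun n => f n ^ 2) l) in *.
    set (B := site_sum (fun n => g n ^ 2) l) in *.
    apply Rle_trans with (f a * g a + sqrt A * sqrt B); [lra|].
    pose proof (pow2_ge_0 (f a)). pose proof (pow2_ge_0 (g a)).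
    apply Rsqr_incr_0_var; [|apply Rmult_le_pos; apply sqrt_pos].
    rewrite Rsqr_mult, !Rsqr_sqrt by lra.
    unfold Rsqr.
    pose proof (sqrt_sqrt A HA) as EA. pose proof (sqrt_sqrt B HB) as EB.
    set (x := sqrt A) in *. set (y := sqrt B) in *.
    rewrite <- EA, <- EB.
    (* Lagrange's identity: this square is the difference of the two sides. *)
    pose proof (pow2_ge_0 (f a * y - g a * x)). simpl in *. nra.
Qed.

(** Membership in l^2 and a norm bound at once, without [Series]: testing on finite sets of sites
    frees both from any order of summation, so translations and sitewise limits act on them
    directly. The clause [0 <= B] is there because the sums see only [B ^ 2]. *)
Definition l2_le (u : Z -> C) (B : R) : Prop :=
  0 <= B /\ forall l, NoDup l -> site_sum (fun n => Cmod (u n) ^ 2) l <= B ^ 2.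

Lemma Cmod_pow2_nonneg (u : Z -> C) n : 0 <= Cmod (u n) ^ 2.
Proof. apply pow2_ge_0. Qed.

(** The interval [-K-1, K], grown by the pair of sites that [fold_Z] adds at each index, so that
    sums over it are exactly the partial sums behind [l2_norm]. *)
Fixpoint sym_range (K : nat) : list Z :=
  match K with
  | O => 0%Z :: (-1)%Z :: nil
  | S K' => Z.of_nat K :: (- Z.of_nat K - 1)%Z :: sym_range K'
  end.

Lemma in_sym_range K n :
  In n (sym_range K) <-> (- Z.of_nat K - 1 <= n <= Z.of_nat K)%Z.
Proof.
  induction K as [|K IH]; cbn [sym_range In].
  - lia.
  - rewrite IH. lia.
Qed.

Lemma NoDup_sym_range K : NoDup (sym_range K).
Proof.
  induction K as [|K IH]; cbn [sym_range].
  - constructor; [intros [H|[]]; lia|]. constructor; [intros []|constructor].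
  - constructor; [cbn [In]; rewrite in_sym_range; lia|].
    constructor; [rewrite in_sym_range; lia|exact IH].
Qed.

Lemma sum_n_S (a : nat -> R) n : sum_n a (S n) = sum_n a n + a (S n).
Proof. exact (sum_Sn a n). Qed.

Lemma sum_fold_Z f K : sum_n (fold_Z f) K = site_sum f (sym_range K).
Proof.
  change (@eq R (sum_n (fold_Z f) K) (site_sum f (sym_range K))).
  induction K as [|K IH].
  - transitivity (fold_Z f 0); [apply (sum_O (fold_Z f))|].
    unfold fold_Z, site_sum; simpl. ring.
  - rewrite sum_n_S, IH. cbn [sym_range]. rewrite !site_sum_cons.
    unfold fold_Z. ring.
Qed.

Lemma sym_range_exhausts (l : list Z) : exists K, incl l (sym_range K).
Proof.
  induction l as [|a l [K HK]].
  - exists O. intros n [].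
  - exists (Nat.max K (Z.abs_nat a)). intros n Hn. apply in_sym_range.
    destruct Hn as [<-|Hn]; [lia|].
    specialize (HK n Hn). apply in_sym_range in HK. lia.
Qed.

Lemma l2_le_sym_range u B :
  0 <= B ->
  (forall K, site_sum (fun n => Cmod (u n) ^ 2) (sym_range K) <= B ^ 2) ->
  l2_le u B.
Proof.
  intros HB H; split; [exact HB|]. intros l Hl.
  destruct (sym_range_exhausts l) as [K HK].
  eapply Rle_trans; [|apply (H K)].
  apply site_sum_incl; auto using Cmod_pow2_nonneg.
Qed.

Lemma fold_Z_nonneg f k : (forall n, 0 <= f n) -> 0 <= fold_Z f k.
Proof. intros H. unfold fold_Z. pose proof (H (Z.of_nat k)).
  pose proof (H (- Z.of_nat k - 1)%Z). lra. Qed.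

(** With [l2_le_in], the bridge to the norm of the statement. Partial sums of nonnegative terms
    increase, hence stay below the value of the convergent series. *)
Lemma in_l2_le u : in_l2 u -> l2_le u (l2_norm u).
Proof.
  intros H. apply l2_le_sym_range; [apply sqrt_pos|]. intros K.
  rewrite <- sum_fold_Z. unfold l2_norm.
  assert (Hs : sum_n (fold_Z (fun n => Cmod (u n) ^ 2)) K
               <= Series (fold_Z (fun n => Cmod (u n) ^ 2))).
  { apply is_lim_seq_incr_compare.
    - exact (Series_correct _ H).
    - intros n. rewrite sum_n_S.
      pose proof (fold_Z_nonneg _ (S n) (Cmod_pow2_nonneg u)). lra. }
  rewrite pow2_sqrt; [exact Hs|]. eapply Rle_trans; [|exact Hs].
  rewrite sum_fold_Z. apply site_sum_nonneg, Cmod_pow2_nonneg.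
Qed.

(** Bounded increasing partial sums converge, and the bound passes to their limit. *)
Lemma l2_le_in u B : l2_le u B -> in_l2 u /\ l2_norm u <= B.
Proof.
  intros [HB H].
  assert (Hb : forall K, sum_n (fold_Z (fun n => Cmod (u n) ^ 2)) K <= B ^ 2)
    by (intros K; rewrite sum_fold_Z; apply H, NoDup_sym_range).
  assert (Hex : in_l2 u).
  { destruct (ex_finite_lim_seq_incr (sum_n (fold_Z (fun n => Cmod (u n) ^ 2))) (B ^ 2))
      as [l Hl].
    - intros n. rewrite sum_n_S.
      pose proof (fold_Z_nonneg _ (S n) (Cmod_pow2_nonneg u)). lra.
    - exact Hb.
    - exists l. exact Hl. }
  split; [exact Hex|]. unfold l2_norm.
  rewrite <- (sqrt_pow2 B HB). apply sqrt_le_1_alt.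
  pose proof (Series_correct _ Hex) as Hs.
  exact (is_lim_seq_le _ (fun _ => B ^ 2)
    (Finite (Series (fold_Z (fun n => Cmod (u n) ^ 2)))) (Finite (B ^ 2))
    Hb Hs (is_lim_seq_const _)).
Qed.

Lemma l2_le_pos u B : l2_le u B -> 0 <= B.
Proof. intros [H _]; exact H. Qed.

Lemma l2_le_weaken u B B' : l2_le u B -> B <= B' -> l2_le u B'.
Proof.
  intros [HB H] HBB; split; [lra|]. intros l Hl.
  eapply Rle_trans; [apply (H l Hl)|]. apply pow_incr; lra.
Qed.

Lemma l2_le_ext u v B : (forall n, u n = v n) -> l2_le u B -> l2_le v B.
Proof.
  intros E [HB H]; split; [exact HB|]. intros l Hl.
  rewrite (site_sum_ext _ (fun n => Cmod (u n) ^ 2)); [now apply H|].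
  intros; now rewrite E.
Qed.

Lemma l2_le_site u B n : l2_le u B -> Cmod (u n) <= B.
Proof.
  intros [HB H].
  assert (NoDup (n :: nil)) as Hn by (repeat constructor; simpl; auto).
  specialize (H _ Hn). rewrite site_sum_cons in H. unfold site_sum in H; simpl map in H.
  simpl fold_right in H.
  apply Rsqr_incr_0_var; [unfold Rsqr; simpl in H; lra|exact HB].
Qed.

Lemma l2_le_dom u v c B :
  0 <= c -> (forall n, Cmod (u n) <= c * Cmod (v n)) -> l2_le v B -> l2_le u (c * B).
Proof.
  intros Hc Hd [HB H]. split; [now apply Rmult_le_pos|]. intros l Hl.
  apply Rle_trans with (c ^ 2 * site_sum (fun n => Cmod (v n) ^ 2) l).
  - rewrite <- site_sum_scal. apply site_sum_le. intros n _.
    rewrite <- Rpow_mult_distr. apply pow_incr. split; [apply Cmod_ge_0|apply Hd].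
  - rewrite Rpow_mult_distr. apply Rmult_le_compat_l; [apply pow2_ge_0|now apply H].
Qed.

Lemma l2_le_dom1 u v B :
  (forall n, Cmod (u n) <= Cmod (v n)) -> l2_le v B -> l2_le u B.
Proof.
  intros Hd H. rewrite <- (Rmult_1_l B). apply (l2_le_dom u v); [lra| |exact H].
  intros n; rewrite Rmult_1_l; apply Hd.
Qed.

Lemma l2_le_zero : l2_le (fun _ => RtoC 0) 0.
Proof.
  split; [lra|]. intros l _.
  rewrite (site_sum_ext _ (fun n => 0 * 0)), site_sum_scal; [lra|].
  intros; rewrite Cmod_0; ring.
Qed.

(** Minkowski's inequality: expand the square of |u| + |v| and bound the mixed sum by
    Cauchy-Schwarz. *)
Lemma l2_le_plus u v A B :
  l2_le u A -> l2_le v B -> l2_le (fun n => (u n + v n)%C) (A + B).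
Proof.
  intros [HA Hu] [HB Hv]. split; [lra|]. intros l Hl.
  specialize (Hu l Hl). specialize (Hv l Hl).
  pose proof (site_sum_Cauchy_Schwarz (fun n => Cmod (u n)) (fun n => Cmod (v n)) l) as CS.
  assert (H1 : sqrt (site_sum (fun n => Cmod (u n) ^ 2) l) <= A).
  { rewrite <- (sqrt_pow2 A HA). now apply sqrt_le_1_alt. }
  assert (H2 : sqrt (site_sum (fun n => Cmod (v n) ^ 2) l) <= B).
  { rewrite <- (sqrt_pow2 B HB). now apply sqrt_le_1_alt. }
  assert (H3 : site_sum (fun n => Cmod (u n) * Cmod (v n)) l <= A * B).
  { eapply Rle_trans; [exact CS|]. apply Rmult_le_compat; auto using sqrt_pos. }
  apply Rle_trans with (site_sum (fun n => Cmod (u n) ^ 2) l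
     + (2 * site_sum (fun n => Cmod (u n) * Cmod (v n)) l
     + site_sum (fun n => Cmod (v n) ^ 2) l)); [|simpl in *; nra].
  rewrite <- site_sum_scal, <- !site_sum_plus. apply site_sum_le. intros n _.
  apply Rle_trans with ((Cmod (u n) + Cmod (v n)) ^ 2); [|nra].
  apply pow_incr. split; [apply Cmod_ge_0|apply Cmod_triangle].
Qed.

Lemma l2_le_opp u B : l2_le u B -> l2_le (fun n => (- u n)%C) B.
Proof. apply l2_le_dom1. intros n. rewrite Cmod_opp. lra. Qed.

Lemma l2_le_minus u v A B :
  l2_le u A -> l2_le v B -> l2_le (fun n => (u n - v n)%C) (A + B).
Proof. intros Hu Hv. exact (l2_le_plus _ _ _ _ Hu (l2_le_opp _ _ Hv)). Qed.

Lemma l2_le_minus_sym u v B :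
  l2_le (fun n => (u n - v n)%C) B -> l2_le (fun n => (v n - u n)%C) B.
Proof.
  apply l2_le_dom1. intros n. rewrite <- Cmod_opp. right. f_equal. ring.
Qed.

Lemma site_sum_map f (h : Z -> Z) l : site_sum f (map h l) = site_sum (fun n => f (h n)) l.
Proof. unfold site_sum. now rewrite map_map. Qed.

(** A translated duplicate-free list is again duplicate-free, so the test sums of the shifted
    sequence are test sums of [u]. *)
Lemma l2_le_shift u m B : l2_le u B -> l2_le (fun n => u (n + m)%Z) B.
Proof.
  intros [HB H]. split; [exact HB|]. intros l Hl.
  rewrite <- (site_sum_map (fun n => Cmod (u n) ^ 2) (fun n => (n + m)%Z)).
  apply H. apply FinFun.Injective_map_NoDup; [|exact Hl].
  intros a b; lia.
Qed.

Lemma l2_le_diff u B : l2_le u B -> l2_le (diff u) (2 * B).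
Proof.
  intros H. replace (2 * B) with (B + B) by ring.
  apply (l2_le_minus u (fun n => u (n + -1)%Z)); [exact H|now apply l2_le_shift].
Qed.

(** Up to a translation the Laplacian is the second backward difference, so shift invariance lets
    [Delta] inherit bounds on [diff (diff u)]. *)
Lemma Delta_diff u n : Delta u n = diff (diff u) (n + 1)%Z.
Proof.
  unfold Delta, diff. replace (n + 1 - 1)%Z with n by lia. ring.
Qed.

Lemma l2_le_Delta u B : l2_le u B -> l2_le (Delta u) (4 * B).
Proof.
  intros H. apply (l2_le_ext (fun n => diff (diff u) (n + 1)%Z)).
  - intros n; symmetry; apply Delta_diff.
  - replace (4 * B) with (2 * (2 * B)) by ring.
    now apply l2_le_shift, l2_le_diff, l2_le_diff.
Qed.

Lemma site_sum_lim (f : nat -> Z -> R) (g : Z -> R) l :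
  (forall n, is_lim_seq (fun k => f k n) (g n)) ->
  is_lim_seq (fun k => site_sum (f k) l) (site_sum g l).
Proof.
  intros H. induction l as [|a l IH].
  - apply is_lim_seq_const.
  - apply (is_lim_seq_plus' _ _ _ _ (H a) IH).
Qed.

(** A Fatou property: each test sum is finite and passes to the limit, so sitewise convergence of
    the moduli suffices. *)
Lemma l2_le_lim (v : nat -> Z -> C) (u : Z -> C) (b : nat -> R) (B : R) :
  (forall n, is_lim_seq (fun k => Cmod (v k n)) (Cmod (u n))) ->
  (forall k, l2_le (v k) (b k)) -> is_lim_seq b B -> l2_le u B.
Proof.
  intros Hlim Hb HbB. split.
  - apply (is_lim_seq_le (fun _ => 0) b (Finite 0) (Finite B)); [|apply is_lim_seq_const|exact HbB].
    intros k; apply (Hb k).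
  - intros l Hl.
    refine (is_lim_seq_le (fun k => site_sum (fun n => Cmod (v k n) ^ 2) l)
      (fun k => b k ^ 2) (Finite (site_sum (fun n => Cmod (u n) ^ 2) l))
      (Finite (B ^ 2)) _ _ _).
    + intros k. now apply Hb.
    + apply (site_sum_lim (fun k n => Cmod (v k n) ^ 2) (fun n => Cmod (u n) ^ 2)).
      intros n.
      simpl. apply (is_lim_seq_mult' _ _ _ _ (Hlim n)).
      apply (is_lim_seq_mult' _ _ _ _ (Hlim n)), is_lim_seq_const.
    + simpl. apply (is_lim_seq_mult' _ _ _ _ HbB).
      apply (is_lim_seq_mult' _ _ _ _ HbB), is_lim_seq_const.
Qed.

(** Terms of the convergent folded series tend to zero, and each of the two sites folded into a term
    is dominated by its square root. *)
Lemma l2_le_tends_to_zero u B :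
  l2_le u B ->
  is_lim_seq (fun k => Cmod (u (Z.of_nat k))) 0 /\
  is_lim_seq (fun k => Cmod (u (- Z.of_nat k - 1)%Z)) 0.
Proof.
  intros H. destruct (l2_le_in _ _ H) as [Hin _].
  pose proof (ex_series_lim_0 _ Hin) as Hl.
  assert (Hsqrt : is_lim_seq (fun k => sqrt (fold_Z (fun n => Cmod (u n) ^ 2) k)) 0).
  { rewrite <- sqrt_0. apply is_lim_seq_continuous; [|exact Hl].
    apply continuity_pt_sqrt; lra. }
  assert (forall a b, 0 <= a -> 0 <= b -> a <= sqrt (a ^ 2 + b ^ 2)).
  { intros a b Ha Hb. rewrite <- (sqrt_pow2 a) at 1 by exact Ha.
    apply sqrt_le_1_alt. pose proof (pow2_ge_0 b). lra. }
  split; apply (is_lim_seq_le_le (fun _ => 0) _ _ 0) with (2 := is_lim_seq_const 0)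
    (3 := Hsqrt); intros k; (split; [apply Cmod_ge_0|]); unfold fold_Z.
  - apply H0; apply Cmod_ge_0.
  - rewrite Rplus_comm. apply H0; apply Cmod_ge_0.
Qed.

(** * Integrals of complex-valued functions and Minkowski's integral inequality *)

Definition is_CInt : (R -> C) -> R -> R -> C -> Prop := is_RInt (V := C_R_NormedModule).

Lemma is_CInt_parts f a b I :
  is_CInt f a b I <->
  is_RInt (fun s => Re (f s)) a b (Re I) /\ is_RInt (fun s => Im (f s)) a b (Im I).
Proof.
  split.
  - intros H. split.
    + exact (is_RInt_fct_extend_fst (U := R_NormedModule) (V := R_NormedModule) f a b I H).
    + exact (is_RInt_fct_extend_snd (U := R_NormedModule) (V := R_NormedModule) f a b I H).
  - intros [H1 H2]. destruct I as [I1 I2].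
    exact (is_RInt_fct_extend_pair (U := R_NormedModule) (V := R_NormedModule) f a b I1 I2 H1 H2).
Qed.

Lemma is_RInt_site_sum (f : Z -> R -> R) (I : Z -> R) a b l :
  (forall n, is_RInt (f n) a b (I n)) ->
  is_RInt (fun s => site_sum (fun n => f n s) l) a b (site_sum I l).
Proof.
  intros H. induction l as [|n l IH].
  - unfold site_sum; simpl. pose proof (is_RInt_const (V := R_NormedModule) a b 0) as H0.
    unfold scal in H0; simpl in H0. unfold mult in H0; simpl in H0.
    now rewrite Rmult_0_r in H0.
  - exact (is_RInt_plus (V := R_NormedModule) _ _ _ _ _ _ (H n) IH).
Qed.

Lemma re_mult_le (z w : C) : Re z * Re w + Im z * Im w <= Cmod z * Cmod w.
Proof.
  pose proof (re_le_Cmod (Cconj z * w)%C) as H.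
  rewrite Cmod_mult, Cmod_conj in H.
  assert (Re (Cconj z * w)%C = Re z * Re w + Im z * Im w) as E
    by (destruct z, w; simpl; ring).
  rewrite E in H. apply Rabs_le_between in H. lra.
Qed.

(* Minkowski by duality: pair the integral with its own conjugate on a finite set of
   sites and apply Cauchy-Schwarz under the integral sign. *)
Lemma l2_le_CInt (f : R -> Z -> C) (I : Z -> C) a b B :
  a <= b -> 0 <= B ->
  (forall n, is_CInt (fun s => f s n) a b (I n)) ->
  (forall s, a < s < b -> l2_le (f s) B) ->
  l2_le I ((b - a) * B).
Proof.
  intros Hab HB HI Hf. split; [apply Rmult_le_pos; lra|]. intros l Hl.
  set (S := site_sum (fun n => Cmod (I n) ^ 2) l).
  assert (HS : 0 <= S) by (apply site_sum_nonneg, Cmod_pow2_nonneg).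
  assert (H1 : is_RInt (fun s => site_sum
      (fun n => Re (I n) * Re (f s n) + Im (I n) * Im (f s n)) l) a b S).
  { replace S with (site_sum (fun n => Re (I n) * Re (I n) + Im (I n) * Im (I n)) l).
    2:{ apply site_sum_ext; intros; rewrite Cmod2_alt; ring. }
    apply (is_RInt_site_sum (fun n s => Re (I n) * Re (f s n) + Im (I n) * Im (f s n))
      (fun n => Re (I n) * Re (I n) + Im (I n) * Im (I n))).
    intros n. destruct (proj1 (is_CInt_parts _ _ _ _) (HI n)) as [Hr Hi].
    exact (is_RInt_plus (V := R_NormedModule) _ _ _ _ _ _
      (is_RInt_scal (V := R_NormedModule) _ _ _ (Re (I n)) _ Hr)
      (is_RInt_scal (V := R_NormedModule) _ _ _ (Im (I n)) _ Hi)). }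
  pose proof (is_RInt_const (V := R_NormedModule) a b (sqrt S * B)) as H2.
  assert (H3 : S <= (b - a) * (sqrt S * B)).
  { refine (is_RInt_le _ _ _ _ _ _ Hab H1 H2 _). intros s Hs.
    apply Rle_trans with (site_sum (fun n => Cmod (I n) * Cmod (f s n)) l).
    { apply site_sum_le; intros; apply re_mult_le. }
    eapply Rle_trans; [apply site_sum_Cauchy_Schwarz|].
    apply Rmult_le_compat_l; [apply sqrt_pos|].
    rewrite <- (sqrt_pow2 B HB). apply sqrt_le_1_alt. now apply Hf. }
  assert (E : sqrt S ^ 2 = S) by now apply pow2_sqrt.
  (* The inequality S <= (b - a) B sqrt S may be divided by sqrt S only when that is nonzero. *)
  destruct (Req_dec (sqrt S) 0) as [Z0|NZ].
  - rewrite Z0 in E. pose proof (pow2_ge_0 ((b - a) * B)).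
    change (S <= ((b - a) * B) ^ 2). lra.
  - change (S <= ((b - a) * B) ^ 2). assert (0 < sqrt S) by (pose proof (sqrt_pos S); lra).
    assert (sqrt S <= (b - a) * B).
    { apply Rmult_le_reg_l with (sqrt S); [assumption|]. simpl in E. nra. }
    rewrite <- E. apply pow_incr; lra.
Qed.

(** * The propagator *)

Lemma in_linf_plus u v :
  in_linf u -> in_linf v -> in_linf (fun n => (u n + v n)%C).
Proof.
  intros [A HA] [B HB]. exists (A + B). intros n.
  eapply Rle_trans; [apply Cmod_triangle|]. specialize (HA n); specialize (HB n); lra.
Qed.

Lemma in_linf_scal c u : in_linf u -> in_linf (fun n => (c * u n)%C).
Proof.
  intros [A HA]. exists (Cmod c * A). intros n. rewrite Cmod_mult.
  apply Rmult_le_compat_l; [apply Cmod_ge_0|apply HA].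
Qed.

Lemma in_linf_shift u m : in_linf u -> in_linf (fun n => u (n + m)%Z).
Proof. intros [A HA]. exists A. intros n. apply HA. Qed.

(** In the form [n + -1] the linearity and shift lemmas of the propagator apply verbatim. *)
Lemma diff_as_sum u : diff u = fun n => (u n + -(1) * u (n + -1)%Z)%C.
Proof. apply functional_extensionality; intros n. unfold diff. unfold Z.sub. simpl Z.opp. ring. Qed.

Lemma in_linf_diff u : in_linf u -> in_linf (diff u).
Proof.
  intros H. rewrite diff_as_sum. apply in_linf_plus; [exact H|].
  now apply (in_linf_scal (-(1))%C (fun n => u (n + -1)%Z)), in_linf_shift.
Qed.

Lemma l2_le_linf u B : l2_le u B -> in_linf u.
Proof. intros H. exists B. intros n. now apply l2_le_site. Qed.

Lemma Delta_bound u M :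
  (forall n, Cmod (u n) <= M) -> forall n, Cmod (Delta u n) <= 4 * M.
Proof.
  intros H n. unfold Delta.
  replace (u (n + 1)%Z + u (n - 1)%Z - RtoC 2 * u n)%C
    with (u (n + 1)%Z + (u (n - 1)%Z + (- u n + - u n)))%C
    by (replace (RtoC 2) with (1 + 1)%C by (now rewrite <- RtoC_plus); ring).
  eapply Rle_trans; [apply Cmod_triangle|].
  pose proof (Cmod_triangle (u (n - 1)%Z) (- u n + - u n)) as H1.
  pose proof (Cmod_triangle (- u n) (- u n)) as H2.
  rewrite Cmod_opp in H2.
  pose proof (H n); pose proof (H (n + 1)%Z); pose proof (H (n - 1)%Z). lra.
Qed.

Lemma in_linf_Delta u : in_linf u -> in_linf (Delta u).
Proof. intros [M HM]. exists (4 * M). now apply Delta_bound. Qed.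

Lemma iter_Delta_bound u M k :
  (forall n, Cmod (u n) <= M) ->
  forall n, Cmod (Nat.iter k Delta u n) <= 4 ^ k * M.
Proof.
  intros H. induction k as [|k IH]; intros n.
  - simpl. rewrite Rmult_1_l. apply H.
  - simpl Nat.iter. simpl pow. rewrite Rmult_assoc. now apply Delta_bound.
Qed.

Lemma iter_Delta_plus u v k n :
  Nat.iter k Delta (fun m => (u m + v m)%C) n
  = (Nat.iter k Delta u n + Nat.iter k Delta v n)%C.
Proof.
  revert n; induction k as [|k IH]; intros n; [reflexivity|].
  simpl Nat.iter. unfold Delta at 1 3 5. rewrite !IH. ring.
Qed.

Lemma iter_Delta_scal c u k n :
  Nat.iter k Delta (fun m => (c * u m)%C) n = (c * Nat.iter k Delta u n)%C.
Proof.
  revert n; induction k as [|k IH]; intros n; [reflexivity|].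
  simpl Nat.iter. unfold Delta at 1 3. rewrite !IH. ring.
Qed.

Lemma iter_Delta_shift u m k n :
  Nat.iter k Delta (fun j => u (j + m)%Z) n = Nat.iter k Delta u (n + m)%Z.
Proof.
  revert n; induction k as [|k IH]; intros n; [reflexivity|].
  simpl Nat.iter. unfold Delta at 1 3. rewrite !IH.
  replace (n + 1 + m)%Z with (n + m + 1)%Z by lia.
  replace (n - 1 + m)%Z with (n + m - 1)%Z by lia. reflexivity.
Qed.

(** The coefficient of t^k: with the power of [t] split off, the real and imaginary parts of the
    propagator become ordinary real power series. *)
Definition prop_coef (kappa : R) (u : Z -> C) (n : Z) (k : nat) : C :=
  (Cpow Ci k * RtoC (kappa ^ k / INR (fact k)) * Nat.iter k Delta u n)%C.

Lemma Re_mult_RtoC z r : Re (z * RtoC r)%C = Re z * r.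
Proof. destruct z; simpl; ring. Qed.

Lemma Im_mult_RtoC z r : Im (z * RtoC r)%C = Im z * r.
Proof. destruct z; simpl; ring. Qed.

Lemma propagator_PSeries kappa t u n :
  propagator kappa t u n =
  (PSeries (fun k => Re (prop_coef kappa u n k)) t,
   PSeries (fun k => Im (prop_coef kappa u n k)) t).
Proof.
  unfold propagator, CSeries.
  assert (E : forall k, (Cpow (Ci * RtoC (kappa * t)) k / RtoC (INR (fact k))
     * Nat.iter k Delta u n)%C = (prop_coef kappa u n k * RtoC (t ^ k))%C).
  { intros k. unfold prop_coef.
    rewrite Cpow_mult_l, <- RtoC_pow, Rpow_mult_distr, RtoC_mult.
    rewrite RtoC_div by apply INR_fact_neq_0. unfold Cdiv. ring. }
  f_equal; apply Series_ext; intros k; rewrite E;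
    [apply Re_mult_RtoC|apply Im_mult_RtoC].
Qed.

Lemma Cmod_Ci : Cmod Ci = 1.
Proof. transitivity (sqrt 1); [unfold Cmod; f_equal; simpl; ring|apply sqrt_1]. Qed.

Lemma Cmod_Ci_pow k : Cmod (Cpow Ci k) = 1.
Proof. now rewrite Cmod_pow, Cmod_Ci, pow1. Qed.

Lemma prop_coef_bound kappa u n k M :
  (forall m, Cmod (u m) <= M) ->
  Cmod (prop_coef kappa u n k) <= (4 * Rabs kappa) ^ k / INR (fact k) * M.
Proof.
  intros H. unfold prop_coef.
  rewrite !Cmod_mult, Cmod_Ci_pow, Cmod_R, Rmult_1_l.
  pose proof (iter_Delta_bound u M k H n) as Hb.
  pose proof (INR_fact_lt_0 k) as Hf.
  unfold Rdiv. rewrite Rabs_mult, <- RPow_abs, (Rabs_pos_eq (/ _))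
    by (left; now apply Rinv_0_lt_compat).
  apply Rle_trans with (Rabs kappa ^ k * / INR (fact k) * (4 ^ k * M)).
  - apply Rmult_le_compat_l; [|exact Hb].
    apply Rmult_le_pos; [apply pow_le, Rabs_pos|left; now apply Rinv_0_lt_compat].
  - rewrite Rpow_mult_distr. right. ring.
Qed.

Lemma is_series_exp x : is_series (fun k => x ^ k / INR (fact k)) (exp x).
Proof.
  eapply is_series_ext; [|exact (is_exp_Reals x)].
  intros k. simpl. rewrite pow_n_pow. unfold scal; simpl. unfold mult; simpl.
  reflexivity.
Qed.

Lemma exp_partial_sum_le x K :
  0 <= x -> sum_n (fun k => x ^ k / INR (fact k)) K <= exp x.
Proof.
  intros Hx. apply is_lim_seq_incr_compare; [exact (is_series_exp x)|].
  intros n. rewrite sum_n_S.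
  assert (0 <= x ^ S n / INR (fact (S n))); [|lra].
  apply Rmult_le_pos; [now apply pow_le|].
  left; apply Rinv_0_lt_compat, INR_fact_lt_0.
Qed.

Lemma exp_term_le x k : 0 <= x -> x ^ k / INR (fact k) <= exp x.
Proof.
  intros Hx. eapply Rle_trans; [|apply (exp_partial_sum_le x k Hx)].
  destruct k as [|k].
  - right. symmetry. apply (sum_O (fun k => x ^ k / INR (fact k))).
  - rewrite sum_n_S.
    assert (0 <= sum_n (fun k => x ^ k / INR (fact k)) k); [|lra].
    clear - Hx. induction k as [|k IH].
    + rewrite sum_O. simpl. lra.
    + rewrite sum_n_S. apply Rplus_le_le_0_compat; [exact IH|].
      apply Rmult_le_pos; [now apply pow_le|].
      left; apply Rinv_0_lt_compat, INR_fact_lt_0.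
Qed.

(** At any [r] the terms are at most M (c|r|)^k / k! <= M exp(c|r|), and bounded terms place |r|
    within the radius of convergence; hence no real number bounds the radius. *)
Lemma CV_radius_exp_type (a : nat -> R) c M :
  0 <= c -> (forall k, Rabs (a k) <= c ^ k / INR (fact k) * M) ->
  CV_radius a = p_infty.
Proof.
  intros Hc H.
  assert (HM : 0 <= M).
  { specialize (H O). simpl in H. pose proof (Rabs_pos (a O)). lra. }
  assert (Hr : forall r, Rbar_le (Finite r) (CV_radius a)).
  { intros r. apply (proj1 (CV_radius_bounded a)).
    exists (exp (c * Rabs r) * M). intros k.
    rewrite Rabs_mult, <- RPow_abs.
    apply Rle_trans with ((c * Rabs r) ^ k / INR (fact k) * M).
    - apply Rle_trans with (c ^ k / INR (fact k) * M * Rabs r ^ k).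
      + apply Rmult_le_compat_r; [apply pow_le, Rabs_pos|apply H].
      + rewrite Rpow_mult_distr. right. field. apply INR_fact_neq_0.
    - apply Rmult_le_compat_r; [exact HM|]. apply exp_term_le.
      apply Rmult_le_pos; [exact Hc|apply Rabs_pos]. }
  destruct (CV_radius a) as [x| |]; [|reflexivity|].
  - specialize (Hr (x + 1)). simpl in Hr. lra.
  - destruct (Hr 0).
Qed.

Lemma im_le_Cmod (z : C) : Rabs (Im z) <= Cmod z.
Proof. eapply Rle_trans; [apply Rmax_r|apply Rmax_Cmod]. Qed.

Lemma CV_radius_prop_coef kappa u n :
  in_linf u ->
  CV_radius (fun k => Re (prop_coef kappa u n k)) = p_infty /\
  CV_radius (fun k => Im (prop_coef kappa u n k)) = p_infty.
Proof.
  intros [M HM].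
  assert (0 <= 4 * Rabs kappa) by (pose proof (Rabs_pos kappa); lra).
  split; apply (CV_radius_exp_type _ (4 * Rabs kappa) M); try assumption; intros k;
    (eapply Rle_trans; [|apply prop_coef_bound; exact HM]).
  - apply re_le_Cmod.
  - apply im_le_Cmod.
Qed.

Lemma ex_pseries_prop_coef kappa u n t :
  in_linf u ->
  ex_pseries (fun k => Re (prop_coef kappa u n k)) t /\
  ex_pseries (fun k => Im (prop_coef kappa u n k)) t.
Proof.
  intros H. destruct (CV_radius_prop_coef kappa u n H) as [H1 H2].
  split; apply CV_radius_inside; [rewrite H1|rewrite H2]; exact I.
Qed.

Lemma PSeries_lin (a b : nat -> R) x y t :
  ex_pseries a t -> ex_pseries b t ->
  PSeries (fun k => x * a k + y * b k) t = x * PSeries a t + y * PSeries b t.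
Proof.
  intros Ha Hb.
  rewrite <- !PSeries_scal, <- PSeries_plus.
  - apply PSeries_ext. intros k. reflexivity.
  - apply ex_pseries_scal; [apply Rmult_comm|exact Ha].
  - apply ex_pseries_scal; [apply Rmult_comm|exact Hb].
Qed.

(** [Series] is total, and its additivity requires convergence; boundedness of [u] and [v] provides
    it. *)
Lemma propagator_plus kappa t u v n :
  in_linf u -> in_linf v ->
  propagator kappa t (fun m => (u m + v m)%C) n
  = (propagator kappa t u n + propagator kappa t v n)%C.
Proof.
  intros Hu Hv. rewrite !propagator_PSeries.
  destruct (ex_pseries_prop_coef kappa u n t Hu) as [Hu1 Hu2].
  destruct (ex_pseries_prop_coef kappa v n t Hv) as [Hv1 Hv2].
  assert (E : forall k, prop_coef kappa (fun m => (u m + v m)%C) n k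
      = (prop_coef kappa u n k + prop_coef kappa v n k)%C)
    by (intros k; unfold prop_coef; rewrite iter_Delta_plus; ring).
  apply injective_projections; cbn [fst snd Cplus].
  - transitivity (1 * PSeries (fun k => Re (prop_coef kappa u n k)) t
      + 1 * PSeries (fun k => Re (prop_coef kappa v n k)) t); [|ring].
    rewrite <- PSeries_lin by assumption. apply PSeries_ext. intros k.
    rewrite E. simpl. unfold Re, Im. ring.
  - transitivity (1 * PSeries (fun k => Im (prop_coef kappa u n k)) t
      + 1 * PSeries (fun k => Im (prop_coef kappa v n k)) t); [|ring].
    rewrite <- PSeries_lin by assumption. apply PSeries_ext. intros k.
    rewrite E. simpl. unfold Re, Im. ring.
Qed.

Lemma propagator_scal kappa t c u n :
  in_linf u ->
  propagator kappa t (fun m => (c * u m)%C) n = (c * propagator kappa t u n)%C.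
Proof.
  intros Hu. rewrite !propagator_PSeries.
  destruct (ex_pseries_prop_coef kappa u n t Hu) as [Hu1 Hu2].
  assert (E : forall k, prop_coef kappa (fun m => (c * u m)%C) n k
      = (c * prop_coef kappa u n k)%C)
    by (intros k; unfold prop_coef; rewrite iter_Delta_scal; ring).
  apply injective_projections; cbn [fst snd Cmult].
  - unfold Rminus. rewrite Ropp_mult_distr_l, <- PSeries_lin by assumption.
    apply PSeries_ext. intros k. rewrite E. simpl. unfold Re, Im. ring.
  - rewrite <- PSeries_lin by assumption.
    apply PSeries_ext. intros k. rewrite E. simpl. unfold Re, Im. ring.
Qed.

Lemma propagator_shift kappa t u m n :
  propagator kappa t (fun j => u (j + m)%Z) n = propagator kappa t u (n + m)%Z.
Proof.
  rewrite !propagator_PSeries. f_equal; apply PSeries_ext; intros k;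
    unfold prop_coef; now rewrite iter_Delta_shift.
Qed.

Lemma propagator_diff kappa t u n :
  in_linf u -> propagator kappa t (diff u) n = diff (propagator kappa t u) n.
Proof.
  intros Hu. rewrite (diff_as_sum u), (diff_as_sum (propagator kappa t u)).
  rewrite propagator_plus; [|exact Hu|].
  - rewrite (propagator_scal kappa t (-(1))%C (fun j => u (j + -1)%Z))
      by now apply in_linf_shift.
    now rewrite propagator_shift.
  - now apply (in_linf_scal (-(1))%C (fun n => u (n + -1)%Z)), in_linf_shift.
Qed.

Lemma Delta_as_diff u : Delta u = fun n => diff (diff u) (n + 1)%Z.
Proof. apply functional_extensionality, Delta_diff. Qed.

Lemma propagator_Delta kappa t u n :
  in_linf u -> propagator kappa t (Delta u) n = Delta (propagator kappa t u) n.
Proof.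
  intros Hu. rewrite Delta_diff, Delta_as_diff, (propagator_shift kappa t (diff (diff u)) 1 n).
  rewrite propagator_diff by now apply in_linf_diff.
  unfold diff at 1 3. now rewrite !propagator_diff by exact Hu.
Qed.

Lemma propagator_0 kappa u n : propagator kappa 0 u n = u n.
Proof.
  rewrite propagator_PSeries, !PSeries_0. unfold prop_coef; simpl.
  destruct (u n) as [x y]. simpl. unfold Re, Im; simpl. f_equal; field.
Qed.

(** Coefficient form of dU/dt u = i kappa U Delta u: the factor k+1 cancels against the factorial,
    and one Laplacian moves onto the datum. *)
Lemma prop_coef_S kappa u n k :
  (RtoC (INR (S k)) * prop_coef kappa u n (S k))%C
  = (Ci * RtoC kappa * prop_coef kappa (Delta u) n k)%C.
Proof.
  unfold prop_coef. rewrite Cpow_S, Nat.iter_succ_r.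
  replace (kappa ^ S k / INR (fact (S k)))
    with (kappa * (kappa ^ k / INR (fact k)) * / INR (S k)).
  - rewrite !RtoC_mult.
    assert (E : (RtoC (INR (S k)) * RtoC (/ INR (S k)))%C = RtoC 1).
    { rewrite <- RtoC_mult, Rinv_r; [reflexivity|]. now apply not_0_INR. }
    set (X := RtoC (INR (S k))) in *. set (Y := RtoC (/ INR (S k))) in *.
    transitivity ((X * Y) * (Ci * RtoC kappa * (Ci ^ k * RtoC (kappa ^ k / INR (fact k)) *
      Nat.iter k Delta (Delta u) n)))%C; [ring|]. rewrite E. ring.
  - replace (fact (S k)) with (S k * fact k)%nat by reflexivity.
    rewrite mult_INR. simpl pow. field.
    split; [apply INR_fact_neq_0|now apply not_0_INR].
Qed.

(** Termwise differentiation, legitimate since the radius of convergence is infinite; the two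
    conjuncts are the real and imaginary parts of the evolution equation. *)
Lemma propagator_derive kappa u n t :
  in_linf u ->
  is_derive (fun s => Re (propagator kappa s u n)) t
    (- kappa * Im (propagator kappa t (Delta u) n)) /\
  is_derive (fun s => Im (propagator kappa s u n)) t
    (kappa * Re (propagator kappa t (Delta u) n)).
Proof.
  intros Hu. destruct (CV_radius_prop_coef kappa u n Hu) as [H1 H2].
  assert (E : forall k, (Re (prop_coef kappa u n (S k)) * INR (S k)
        = - kappa * Im (prop_coef kappa (Delta u) n k)) /\
      (Im (prop_coef kappa u n (S k)) * INR (S k)
        = kappa * Re (prop_coef kappa (Delta u) n k))).
  { intros k. rewrite <- Re_mult_RtoC, <- Im_mult_RtoC.
    rewrite Cmult_comm, prop_coef_S.
    destruct (prop_coef kappa (Delta u) n k) as [x y]. simpl. split; ring. }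
  split.
  - apply (is_derive_ext (PSeries (fun k => Re (prop_coef kappa u n k)))).
    { intros s. now rewrite propagator_PSeries. }
    replace (- kappa * Im (propagator kappa t (Delta u) n))
      with (PSeries (PS_derive (fun k => Re (prop_coef kappa u n k))) t).
    { apply is_derive_PSeries. rewrite H1. exact I. }
    rewrite propagator_PSeries. simpl Im. rewrite <- PSeries_scal.
    apply PSeries_ext. intros k. unfold PS_derive.
    rewrite Rmult_comm. apply (proj1 (E k)).
  - apply (is_derive_ext (PSeries (fun k => Im (prop_coef kappa u n k)))).
    { intros s. now rewrite propagator_PSeries. }
    replace (kappa * Re (propagator kappa t (Delta u) n))
      with (PSeries (PS_derive (fun k => Im (prop_coef kappa u n k))) t).
    { apply is_derive_PSeries. rewrite H2. exact I. }
    rewrite propagator_PSeries. simpl Re. rewrite <- PSeries_scal.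
    apply PSeries_ext. intros k. unfold PS_derive.
    rewrite Rmult_comm. apply (proj2 (E k)).
Qed.

Lemma propagator_continuous kappa u n t :
  in_linf u ->
  continuous (fun s => Re (propagator kappa s u n)) t /\
  continuous (fun s => Im (propagator kappa s u n)) t.
Proof.
  intros Hu. destruct (propagator_derive kappa u n t Hu) as [H1 H2].
  split.
  - exact (ex_derive_continuous (V := R_NormedModule) _ t (ex_intro _ _ H1)).
  - exact (ex_derive_continuous (V := R_NormedModule) _ t (ex_intro _ _ H2)).
Qed.

(** The fundamental theorem of calculus for the evolution equation at one site. It serves twice: for
    increments of U in time and for the exact integration of the background. *)
Lemma CInt_propagator kappa u n a b :
  in_linf u ->
  is_CInt (fun s => (Ci * RtoC kappa * propagator kappa s (Delta u) n)%C) a b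
    (propagator kappa b u n - propagator kappa a u n)%C.
Proof.
  intros Hu. pose proof (in_linf_Delta u Hu) as HD. apply is_CInt_parts. split.
  - apply (is_RInt_ext (fun s => - kappa * Im (propagator kappa s (Delta u) n))).
    { intros s _. simpl. unfold Re, Im. ring. }
    apply (is_RInt_derive (V := R_CompleteNormedModule)
      (fun s => Re (propagator kappa s u n))); intros s _.
    + exact (proj1 (propagator_derive kappa u n s Hu)).
    + exact (continuous_scal_r (V := R_NormedModule) (- kappa) _ s
        (proj2 (propagator_continuous kappa (Delta u) n s HD))).
  - apply (is_RInt_ext (fun s => kappa * Re (propagator kappa s (Delta u) n))).
    { intros s _. simpl. unfold Re, Im. ring. }
    apply (is_RInt_derive (V := R_CompleteNormedModule)
      (fun s => Im (propagator kappa s u n))); intros s _.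
    + exact (proj2 (propagator_derive kappa u n s Hu)).
    + exact (continuous_scal_r (V := R_NormedModule) kappa _ s
        (proj1 (propagator_continuous kappa (Delta u) n s HD))).
Qed.

(** The substitution of t - s for s brings an integral of U(s) into Duhamel's form. *)
Lemma is_CInt_reflect (f : R -> C) t I :
  is_CInt f 0 t I -> is_CInt (fun s => f (t - s)) 0 t I.
Proof.
  rewrite !is_CInt_parts.
  assert (G : forall (g : R -> R) J, is_RInt g 0 t J -> is_RInt (fun s => g (t - s)) 0 t J).
  { intros g J H.
    apply is_RInt_swap in H.
    assert (H' : is_RInt g (-1 * 0 + t) (-1 * t + t) (opp J)).
    { replace (-1 * 0 + t) with t by ring. now replace (-1 * t + t) with 0 by ring. }
    apply is_RInt_comp_lin in H'.
    apply is_RInt_opp in H'.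
    replace (opp (opp J)) with J in H' by (symmetry; apply opp_opp).
    eapply is_RInt_ext; [|exact H'].
    intros s _. unfold scal, opp; simpl. unfold mult; simpl.
    replace (-1 * s + t) with (t - s) by ring. ring. }
  intros [H1 H2]. split; [apply (G (fun s => Re (f s)))|apply (G (fun s => Im (f s)))];
    assumption.
Qed.

Lemma is_lim_seq_Cmod (a b : nat -> R) (x y : R) :
  is_lim_seq a x -> is_lim_seq b y ->
  is_lim_seq (fun k => Cmod (a k, b k)) (Cmod (x, y)).
Proof.
  intros Ha Hb. unfold Cmod; simpl.
  apply (is_lim_seq_continuous sqrt).
  - apply continuity_pt_sqrt. nra.
  - apply is_lim_seq_plus'; (apply is_lim_seq_mult'; [assumption|]);
      (apply is_lim_seq_mult'; [assumption|apply is_lim_seq_const]).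
Qed.

(* Superseded by [propagator_l2_contraction], whose proof needs an a priori l^2 bound. *)
Lemma propagator_l2_exp kappa t u B :
  l2_le u B -> l2_le (propagator kappa t u) (exp (4 * Rabs (kappa * t)) * B).
Proof.
  intros Hu.
  set (c := fun n k => (prop_coef kappa u n k * RtoC (t ^ k))%C).
  set (e := fun k => (4 * Rabs (kappa * t)) ^ k / INR (fact k)).
  pose proof (l2_le_pos _ _ Hu) as HB.
  assert (Hx : 0 <= 4 * Rabs (kappa * t)) by (pose proof (Rabs_pos (kappa * t)); lra).
  assert (Hiter : forall k, l2_le (Nat.iter k Delta u) (4 ^ k * B)).
  { induction k as [|k IH]; simpl; [now rewrite Rmult_1_l|].
    rewrite Rmult_assoc. now apply l2_le_Delta. }
  assert (Hterm : forall k, l2_le (fun n => c n k) (e k * B)).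
  { intros k.
    replace (e k * B) with (Rabs ((kappa * t) ^ k / INR (fact k)) * (4 ^ k * B)).
    - eapply l2_le_dom; [apply Rabs_pos| |apply Hiter].
      intros n. unfold c, prop_coef. rewrite !Cmod_mult, Cmod_Ci_pow, !Cmod_R.
      right. unfold Rdiv. rewrite Rpow_mult_distr, !Rabs_mult. ring.
    - unfold e, Rdiv. rewrite Rabs_mult, <- RPow_abs, (Rabs_pos_eq (/ _))
        by (left; apply Rinv_0_lt_compat, INR_fact_lt_0).
      rewrite (Rpow_mult_distr 4). ring. }
  assert (Hsum : forall K, l2_le
      (fun n => (sum_n (fun k => Re (c n k)) K, sum_n (fun k => Im (c n k)) K))
      (sum_n e K * B)).
  { induction K as [|K IH].
    - replace (sum_n e 0) with (e O) by (symmetry; apply (sum_O e)).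
      apply (l2_le_ext (fun n => c n O)); [|exact (Hterm O)].
      intros n. rewrite !sum_O. now destruct (c n O).
    - rewrite sum_n_S, Rmult_plus_distr_r.
      eapply l2_le_ext; [|exact (l2_le_plus _ _ _ _ IH (Hterm (S K)))].
      intros n. rewrite !sum_n_S. reflexivity. }
  refine (l2_le_lim (fun K n => (sum_n (fun k => Re (c n k)) K, sum_n (fun k => Im (c n k)) K))
    _ (fun _ => exp (4 * Rabs (kappa * t)) * B) _ _ _ _).
  - intros n. rewrite propagator_PSeries.
    destruct (ex_pseries_prop_coef kappa u n t (l2_le_linf _ _ Hu)) as [H1 H2].
    apply is_lim_seq_Cmod.
    + pose proof (PSeries_correct _ _ H1) as H.
      eapply is_series_ext in H; [exact H|]. intros k. unfold c.
      rewrite Re_mult_RtoC, pow_n_pow. unfold scal; simpl. unfold mult; simpl. ring.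
    + pose proof (PSeries_correct _ _ H2) as H.
      eapply is_series_ext in H; [exact H|]. intros k. unfold c.
      rewrite Im_mult_RtoC, pow_n_pow. unfold scal; simpl. unfold mult; simpl. ring.
  - intros K. eapply l2_le_weaken; [apply Hsum|].
    apply Rmult_le_compat_r; [exact HB|]. now apply exp_partial_sum_le.
  - apply is_lim_seq_const.
Qed.

(** * Energy estimates *)

(** [sym_range K] enumerates consecutive sites, so only the two ends survive, at K+1 and -K-1. *)
Lemma site_sum_telescope (F : Z -> R) K :
  site_sum (fun n => F (n + 1)%Z - F n) (sym_range K)
  = F (Z.of_nat (S K)) - F (- Z.of_nat K - 1)%Z.
Proof.
  induction K as [|K IH].
  - unfold site_sum; simpl. ring.
  - cbn [sym_range]. rewrite !site_sum_cons, IH.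
    replace (Z.of_nat (S K) + 1)%Z with (Z.of_nat (S (S K))) by lia.
    replace (- Z.of_nat (S K) - 1 + 1)%Z with (- Z.of_nat K - 1)%Z by lia. ring.
Qed.

Lemma Delta_diff_sub u n : Delta u n = (diff u (n + 1)%Z - diff u n)%C.
Proof. rewrite Delta_diff. unfold diff. replace (n + 1 - 1)%Z with n by lia. ring. Qed.

(** Integrate the evolution equation and apply Minkowski. Only the evolution of [Delta u] has to lie
    in l^2, so a background that is merely bounded is covered. *)
Lemma propagator_increment_l2 kappa u a b B :
  0 <= kappa -> a <= b -> 0 <= B -> in_linf u ->
  (forall s, a <= s <= b -> l2_le (propagator kappa s (Delta u)) B) ->
  l2_le (fun n => (propagator kappa b u n - propagator kappa a u n)%C)
    ((b - a) * (kappa * B)).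
Proof.
  intros Hk Hab HB Hu H.
  apply (l2_le_CInt (fun s n => (Ci * RtoC kappa * propagator kappa s (Delta u) n)%C));
    [exact Hab|now apply Rmult_le_pos| |].
  - intros n. now apply CInt_propagator.
  - intros s Hs.
    apply (l2_le_dom _ (propagator kappa s (Delta u))); [exact Hk| |apply H; lra].
    intros n. rewrite !Cmod_mult, Cmod_R, (Rabs_pos_eq kappa Hk), Cmod_Ci. lra.
Qed.

(** The left side is the imaginary part of z times the conjugate of w; multiplying by i reduces it
    to a real part. *)
Lemma im_mult_le (z w : C) : Im z * Re w - Re z * Im w <= Cmod z * Cmod w.
Proof.
  pose proof (re_mult_le (Ci * Cconj z) (Cconj w)) as H.
  rewrite Cmod_mult, !Cmod_conj in H.
  rewrite Cmod_Ci in H.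
  destruct z, w; simpl in *. lra.
Qed.

Lemma propagator_Cmod_continuous kappa u n t :
  in_linf u -> continuous (fun s => Cmod (propagator kappa s u n)) t.
Proof.
  intros Hu. destruct (propagator_continuous kappa u n t Hu) as [H1 H2].
  apply (continuous_ext (fun s => sqrt (Re (propagator kappa s u n) * Re (propagator kappa s u n)
    + Im (propagator kappa s u n) * Im (propagator kappa s u n)))).
  - intros s. unfold Cmod, Re, Im. f_equal. ring.
  - apply (continuous_comp _ sqrt).
    + exact (continuous_plus (V := R_NormedModule) _ _ t
        (continuous_mult (K := R_AbsRing) _ _ t H1 H1)
        (continuous_mult (K := R_AbsRing) _ _ t H2 H2)).
    + apply continuity_pt_filterlim, continuity_pt_sqrt.
      unfold plus, mult; simpl. nra.
Qed.

(* Summation by parts on [-K-1, K] turns the derivative of the truncated energy of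
   [w = U(s) u - r] into [2 kappa Im <r', U(s) u'>] plus two boundary terms; the time
   integrals of the latter form an l^2 sequence in [K], hence vanish in the limit.
   With [r = 0] this gives contractivity, with [r = u] the [sqrt t] bound for the
   free evolution of the background. *)
Lemma propagator_energy kappa t u r A R0 B :
  0 <= kappa -> 0 <= t -> in_linf u ->
  l2_le (fun n => (u n - r n)%C) A -> l2_le (diff r) R0 ->
  0 <= B -> (forall s, 0 <= s <= t -> l2_le (propagator kappa s (diff u)) B) ->
  l2_le (fun n => (propagator kappa t u n - r n)%C) (sqrt (A ^ 2 + 2 * kappa * t * R0 * B)).
Proof.
  intros Hk Ht Hu HA HR HB HD.
  pose proof (l2_le_pos _ _ HA) as HA0. pose proof (l2_le_pos _ _ HR) as HR0.
  assert (Hrhs : 0 <= A ^ 2 + 2 * kappa * t * R0 * B).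
  { assert (0 <= kappa * t * (R0 * B)) by (repeat apply Rmult_le_pos; assumption).
    pose proof (pow2_ge_0 A). nra. }
  pose proof (in_linf_diff u Hu) as Hdu. pose proof (in_linf_Delta u Hu) as HDu.
  set (D := fun n s => propagator kappa s (diff u) n).
  set (w := fun n s => (propagator kappa s u n - r n)%C).
  (* A crude bound on the l^2 norm of [w] over [0,t] from the increment estimate, with 2B for the
     evolution of [Delta u]. It only multiplies boundary terms that vanish in the limit. *)
  set (W := A + t * (kappa * (2 * B))).
  assert (Hwl : forall s, 0 <= s <= t -> l2_le (fun n => w n s) W).
  { intros s Hs. unfold w, W.
    apply (l2_le_ext (fun n => ((u n - r n) + (propagator kappa s u n - propagator kappa 0 u n))%C)).
    { intros n. rewrite propagator_0. ring. }
    apply l2_le_plus; [exact HA|].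
    eapply l2_le_weaken.
    - apply (propagator_increment_l2 kappa u 0 s (2 * B)); try lra; [exact Hu|].
      intros s' Hs'. rewrite Delta_as_diff.
      apply (l2_le_ext (fun n => diff (propagator kappa s' (diff u)) (n + 1)%Z)).
      + intros n. rewrite (propagator_shift kappa s' (diff (diff u)) 1).
        symmetry. now apply propagator_diff.
      + apply (l2_le_shift (diff (propagator kappa s' (diff u)))), l2_le_diff, HD. lra.
    - apply Rmult_le_compat_r; [|lra]. apply Rmult_le_pos; lra. }
  assert (Hwd : forall n s, (w n s - w (n - 1)%Z s)%C = (D n s - diff r n)%C).
  { intros n s. unfold w, D. rewrite propagator_diff by exact Hu. unfold diff. ring. }
  (* [F n] is the flux Im(w_(n-1) conj D_n), [H n] is Im(r'_n conj D_n), and [L n] is the time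
     derivative 2 kappa Im(w_n conj(D_(n+1) - D_n)) of |w_n|^2. Substituting w_n - w_(n-1) = D_n -
     r'_n gives the stated form, as |D_n|^2 is real and drops out. *)
  set (F := fun n s => Im (w (n - 1)%Z s) * Re (D n s) - Re (w (n - 1)%Z s) * Im (D n s)).
  set (H := fun n s => Im (diff r n) * Re (D n s) - Re (diff r n) * Im (D n s)).
  set (L := fun n s => 2 * kappa * ((F (n + 1)%Z s - F n s) + H n s)).
  assert (HL : forall n, is_RInt (L n) 0 t (Cmod (w n t) ^ 2 - Cmod (w n 0) ^ 2)).
  { intros n.
    apply (is_RInt_ext (fun s =>
      2 * Re (w n s) * (- kappa * Im (propagator kappa s (Delta u) n))
      + 2 * Im (w n s) * (kappa * Re (propagator kappa s (Delta u) n)))).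
    { intros s _.
      assert (E : propagator kappa s (Delta u) n = (D (n + 1)%Z s - D n s)%C).
      { rewrite propagator_Delta by exact Hu. rewrite Delta_diff_sub.
        unfold D. now rewrite !propagator_diff by exact Hu. }
      rewrite E. unfold L, F, H. replace (n + 1 - 1)%Z with n by lia.
      assert (Er : diff r n = (D n s - (w n s - w (n - 1)%Z s))%C) by (rewrite Hwd; ring).
      rewrite Er. destruct (w n s), (w (n - 1)%Z s), (D n s), (D (n + 1)%Z s).
      simpl. ring. }
    rewrite !Cmod2_alt.
    apply (is_RInt_derive (V := R_CompleteNormedModule)
      (fun s => Re (w n s) ^ 2 + Im (w n s) ^ 2)); intros s _.
    - destruct (propagator_derive kappa u n s Hu) as [H1 H2].
      assert (G1 : is_derive (fun s => Re (w n s)) s (- kappa * Im (propagator kappa s (Delta u) n))).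
      { apply (is_derive_ext (fun s => Re (propagator kappa s u n) - Re (r n))).
        - intros; reflexivity.
        - replace (- kappa * _) with
            (minus (- kappa * Im (propagator kappa s (Delta u) n)) 0)
            by (unfold minus, plus, opp; simpl; ring).
          exact (is_derive_minus _ _ _ _ _ H1 (is_derive_const _ _)). }
      assert (G2 : is_derive (fun s => Im (w n s)) s (kappa * Re (propagator kappa s (Delta u) n))).
      { apply (is_derive_ext (fun s => Im (propagator kappa s u n) - Im (r n))).
        - intros; reflexivity.
        - replace (kappa * _) with
            (minus (kappa * Re (propagator kappa s (Delta u) n)) 0)
            by (unfold minus, plus, opp; simpl; ring).
          exact (is_derive_minus _ _ _ _ _ H2 (is_derive_const _ _)). }
      pose proof (is_derive_plus _ _ _ _ _ (is_derive_pow _ 2 _ _ G1) (is_derive_pow _ 2 _ _ G2)) as G.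
      eapply is_derive_ext; [|]; cycle 1.
      + match type of G with is_derive _ _ ?l =>
          match goal with |- is_derive _ _ ?l' => replace l' with l; [exact G|] end end.
        unfold plus; simpl. ring.
      + intros; reflexivity.
    - destruct (propagator_continuous kappa u n s Hu) as [C1 C2].
      destruct (propagator_continuous kappa (Delta u) n s HDu) as [C3 C4].
      assert (K1 : continuous (fun s => Re (w n s)) s).
      { exact (continuous_minus (V := R_NormedModule) _ (fun _ => Re (r n)) s C1
          (continuous_const (Re (r n)) s)). }
      assert (K2 : continuous (fun s => Im (w n s)) s).
      { exact (continuous_minus (V := R_NormedModule) _ (fun _ => Im (r n)) s C2
          (continuous_const (Im (r n)) s)). }
      exact (continuous_plus (V := R_NormedModule) _ _ s
        (continuous_mult (K := R_AbsRing) _ _ s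
          (continuous_scal_r (V := R_NormedModule) 2 _ s K1)
          (continuous_scal_r (V := R_NormedModule) (- kappa) _ s C4))
        (continuous_mult (K := R_AbsRing) _ _ s
          (continuous_scal_r (V := R_NormedModule) 2 _ s K2)
          (continuous_scal_r (V := R_NormedModule) kappa _ s C3))). }
  (* Decay of D_n(s) in n at each time does not by itself control the time integral of the flux.
     Minkowski's inequality puts [g] in l^2, so it vanishes at infinity. *)
  set (g := fun n => RInt (fun s => Cmod (D n s)) 0 t).
  assert (Hg : forall n, is_RInt (fun s => Cmod (D n s)) 0 t (g n)).
  { intros n. apply (RInt_correct (V := R_CompleteNormedModule)).
    apply (ex_RInt_continuous (V := R_CompleteNormedModule)). intros s _.
    exact (propagator_Cmod_continuous kappa (diff u) n s Hdu). }
  assert (Hgl : l2_le (fun n => RtoC (g n)) ((t - 0) * B)).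
  { apply (l2_le_CInt (fun s n => RtoC (Cmod (D n s)))); [exact Ht|exact HB| |].
    - intros n. apply is_CInt_parts. split; simpl.
      + apply Hg.
      + pose proof (is_RInt_const (V := R_NormedModule) 0 t 0) as H0.
        unfold scal in H0; simpl in H0. unfold mult in H0; simpl in H0.
        now rewrite Rmult_0_r in H0.
    - intros s Hs. apply (l2_le_dom1 _ (propagator kappa s (diff u))); [|apply HD; lra].
      intros n. rewrite Cmod_R, Rabs_pos_eq by apply Cmod_ge_0. apply Rle_refl. }
  set (bd := fun K : nat => 2 * kappa * W *
     (Cmod (RtoC (g (Z.of_nat (S K)))) + Cmod (RtoC (g (- Z.of_nat K - 1)%Z)))).
  assert (Hbd : is_lim_seq bd 0).
  { destruct (l2_le_tends_to_zero _ _ Hgl) as [L1 L2].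
    apply (is_lim_seq_incr_1 (fun k => Cmod (RtoC (g (Z.of_nat k))))) in L1.
    replace (Finite 0) with (Rbar_mult (2 * kappa * W) (Finite (0 + 0)))
      by (simpl; f_equal; ring).
    apply is_lim_seq_scal_l. exact (is_lim_seq_plus' _ _ _ _ L1 L2). }
  assert (Hgpos : forall n, 0 <= g n).
  { intros n. apply (RInt_ge_0 _ 0 t Ht).
    - exists (g n). apply Hg.
    - intros; apply Cmod_ge_0. }
  assert (HE : forall K, site_sum (fun n => Cmod (w n t) ^ 2) (sym_range K)
     <= A ^ 2 + 2 * kappa * t * R0 * B + bd K).
  { intros K.
    assert (I1 : is_RInt (fun s => site_sum (fun n => L n s) (sym_range K)) 0 t
      (site_sum (fun n => Cmod (w n t) ^ 2) (sym_range K)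
       - site_sum (fun n => Cmod (w n 0) ^ 2) (sym_range K))).
    { replace (site_sum (fun n => Cmod (w n t) ^ 2) (sym_range K)
       - site_sum (fun n => Cmod (w n 0) ^ 2) (sym_range K)) with
       (site_sum (fun n => Cmod (w n t) ^ 2 - Cmod (w n 0) ^ 2) (sym_range K)).
      - apply (is_RInt_site_sum L). exact HL.
      - rewrite (site_sum_ext _ (fun n => Cmod (w n t) ^ 2 + (-1) * Cmod (w n 0) ^ 2))
          by (intros; ring).
        rewrite site_sum_plus, site_sum_scal. ring. }
    pose proof (is_RInt_scal (V := R_NormedModule) _ _ _ (2 * kappa * W) _
       (is_RInt_plus (V := R_NormedModule) _ _ _ _ _ _
          (Hg (Z.of_nat (S K))) (Hg (- Z.of_nat K - 1)%Z))) as I2.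
    pose proof (is_RInt_plus (V := R_NormedModule) _ _ _ _ _ _ I2
      (is_RInt_const (V := R_NormedModule) 0 t (2 * kappa * (R0 * B)))) as I3.
    clear I2.
    assert (H0 : site_sum (fun n => Cmod (w n 0) ^ 2) (sym_range K) <= A ^ 2).
    { rewrite (site_sum_ext _ (fun n => Cmod (u n - r n)%C ^ 2)).
      - apply HA, NoDup_sym_range.
      - intros n _. unfold w. now rewrite propagator_0. }
    unfold bd. rewrite !Cmod_R, !Rabs_pos_eq by apply Hgpos.
    cut (site_sum (fun n => Cmod (w n t) ^ 2) (sym_range K)
       - site_sum (fun n => Cmod (w n 0) ^ 2) (sym_range K)
       <= 2 * kappa * W * (g (Z.of_nat (S K)) + g (- Z.of_nat K - 1)%Z)
          + (t - 0) * (2 * kappa * (R0 * B))); [lra|].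
    refine (is_RInt_le _ _ _ _ _ _ Ht I1 I3 _). intros s Hs.
    change (site_sum (fun n => L n s) (sym_range K)
      <= 2 * kappa * W * (Cmod (D (Z.of_nat (S K)) s) + Cmod (D (- Z.of_nat K - 1)%Z s))
         + 2 * kappa * (R0 * B)).
    unfold L. rewrite site_sum_scal, site_sum_plus.
    rewrite (site_sum_telescope (fun n => F n s)).
    assert (HH : site_sum (fun n => H n s) (sym_range K) <= R0 * B).
    { apply Rle_trans with (site_sum (fun n => Cmod (diff r n) * Cmod (D n s)) (sym_range K)).
      - apply site_sum_le. intros n _. apply im_mult_le.
      - eapply Rle_trans; [apply site_sum_Cauchy_Schwarz|].
        apply Rmult_le_compat; try apply sqrt_pos.
        + rewrite <- (sqrt_pow2 R0 HR0). apply sqrt_le_1_alt. apply HR, NoDup_sym_range.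
        + rewrite <- (sqrt_pow2 B HB). apply sqrt_le_1_alt. refine (proj2 (HD s _) _ (NoDup_sym_range K)). lra. }
    assert (HF1 : F (Z.of_nat (S K)) s <= W * Cmod (D (Z.of_nat (S K)) s)).
    { eapply Rle_trans; [apply im_mult_le|]. apply Rmult_le_compat_r; [apply Cmod_ge_0|].
      refine (l2_le_site (fun n => w n s) W _ (Hwl s _)). lra. }
    assert (HF2 : - F (- Z.of_nat K - 1)%Z s <= W * Cmod (D (- Z.of_nat K - 1)%Z s)).
    { apply Rle_trans with (Cmod (- w (- Z.of_nat K - 1 - 1)%Z s) * Cmod (D (- Z.of_nat K - 1)%Z s)).
      - eapply Rle_trans; [|apply im_mult_le]. unfold F. simpl. unfold Re, Im. lra.
      - apply Rmult_le_compat_r; [apply Cmod_ge_0|]. rewrite Cmod_opp.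
        refine (l2_le_site (fun n => w n s) W _ (Hwl s _)). lra. }
    assert (0 <= 2 * kappa) by lra.
    apply Rle_trans with (2 * kappa * (W * (Cmod (D (Z.of_nat (S K)) s)
       + Cmod (D (- Z.of_nat K - 1)%Z s)) + R0 * B)).
    - apply Rmult_le_compat_l; [assumption|]. lra.
    - right. ring. }
  apply l2_le_sym_range; [apply sqrt_pos|]. intros K.
  rewrite pow2_sqrt by exact Hrhs.
  (* The sum over a fixed interval is at most the sum over each larger one, whose boundary term
     tends to zero as [j] grows. *)
  assert (Hlim : is_lim_seq (fun j => A ^ 2 + 2 * kappa * t * R0 * B + bd (j + K)%nat)
     (A ^ 2 + 2 * kappa * t * R0 * B)).
  { replace (Finite (A ^ 2 + 2 * kappa * t * R0 * B))
      with (Finite (A ^ 2 + 2 * kappa * t * R0 * B + 0)) by (f_equal; ring).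
    apply is_lim_seq_plus'; [apply is_lim_seq_const|].
    now apply is_lim_seq_incr_n. }
  refine (is_lim_seq_le (fun _ => site_sum (fun n => Cmod (w n t) ^ 2) (sym_range K)) _
    (Finite (site_sum (fun n => Cmod (w n t) ^ 2) (sym_range K)))
    (Finite (A ^ 2 + 2 * kappa * t * R0 * B)) _ (is_lim_seq_const _) Hlim).
  intros j. eapply Rle_trans; [|apply HE].
  apply site_sum_incl; [intros; apply pow2_ge_0|apply NoDup_sym_range|].
  intros n. rewrite !in_sym_range. lia.
Qed.

(** The energy estimate with r = 0: there [R0 = 0] kills the correction whatever [M] is, so the
    exponential bound suffices as input and leaves no trace in the result. *)
Lemma propagator_l2_contraction kappa t u B :
  0 <= kappa -> 0 <= t -> l2_le u B -> l2_le (propagator kappa t u) B.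
Proof.
  intros Hk Ht Hu. pose proof (l2_le_pos _ _ Hu) as HB.
  set (M := exp (4 * Rabs (kappa * t)) * (2 * B)).
  assert (HM : 0 <= M) by (apply Rmult_le_pos; [left; apply exp_pos|lra]).
  apply (l2_le_ext (fun n => (propagator kappa t u n - 0)%C)); [intros; ring|].
  replace B with (sqrt (B ^ 2 + 2 * kappa * t * 0 * M))
    by (rewrite Rmult_0_r, Rmult_0_l, Rplus_0_r; now apply sqrt_pow2).
  apply (propagator_energy kappa t u (fun _ => RtoC 0) B 0 M); auto.
  - now apply l2_le_linf with B.
  - apply (l2_le_ext u); [intros; ring|exact Hu].
  - apply (l2_le_ext (fun _ => RtoC 0)); [intros; unfold diff; ring|apply l2_le_zero].
  - intros s Hs. eapply l2_le_weaken; [apply propagator_l2_exp, l2_le_diff, Hu|].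
    apply Rmult_le_compat_r; [lra|].
    assert (4 * Rabs (kappa * s) <= 4 * Rabs (kappa * t)).
    { rewrite !Rabs_pos_eq by (apply Rmult_le_pos; lra).
      assert (kappa * s <= kappa * t) by (apply Rmult_le_compat_l; lra). lra. }
    destruct H as [H|H]; [left; now apply exp_increasing|rewrite H; apply Rle_refl].
Qed.

(** The energy estimate with r = u: the initial distance is zero, and [R0] and the bound on the
    evolution of [diff u] are both [B], the latter by contractivity. *)
Lemma propagator_background_l2 kappa t u B :
  0 <= kappa -> 0 <= t -> in_linf u -> l2_le (diff u) B ->
  l2_le (fun n => (propagator kappa t u n - u n)%C) (sqrt (2 * kappa) * B * sqrt t).
Proof.
  intros Hk Ht Hu HD. pose proof (l2_le_pos _ _ HD) as HB.
  replace (sqrt (2 * kappa) * B * sqrt t) with (sqrt (0 ^ 2 + 2 * kappa * t * B * B)).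
  - apply propagator_energy; auto.
    + apply (l2_le_ext (fun _ => RtoC 0)); [intros; ring|apply l2_le_zero].
    + intros s Hs. apply propagator_l2_contraction; tauto.
  - replace (0 ^ 2 + 2 * kappa * t * B * B) with ((2 * kappa) * B ^ 2 * t) by ring.
    rewrite !sqrt_mult; try lra; try apply pow2_ge_0.
    + now rewrite sqrt_pow2.
    + apply Rmult_le_pos; [lra|apply pow2_ge_0].
Qed.

Lemma propagator_l2_Lipschitz kappa a b u B :
  0 <= kappa -> 0 <= a <= b -> l2_le u B ->
  l2_le (fun n => (propagator kappa b u n - propagator kappa a u n)%C)
    ((b - a) * (kappa * (4 * B))).
Proof.
  intros Hk [Ha Hab] Hu. pose proof (l2_le_pos _ _ Hu).
  apply propagator_increment_l2; try lra.
  - now apply l2_le_linf with B.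
  - intros s Hs. apply propagator_l2_contraction; [exact Hk|lra|now apply l2_le_Delta].
Qed.

(** * The nonlinearity *)

Lemma rpow_pos_eq x a : 0 < x -> rpow x a = Rpower x a.
Proof. intros H. unfold rpow. destruct (Req_EM_T x 0); [lra|reflexivity]. Qed.

Lemma Rpower_nonneg x a : 0 <= Rpower x a.
Proof. left. apply exp_pos. Qed.

Lemma rpow_nonneg x a : 0 <= rpow x a.
Proof. unfold rpow. destruct (Req_EM_T x 0); [lra|apply Rpower_nonneg]. Qed.

Lemma rpow_le x y a : 0 <= a -> 0 <= x <= y -> rpow x a <= rpow y a.
Proof.
  intros Ha [Hx Hxy]. destruct (Req_dec x 0) as [->|Hx0].
  - unfold rpow at 1. destruct (Req_EM_T 0 0); [apply rpow_nonneg|lra].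
  - rewrite !rpow_pos_eq by lra. apply Rle_Rpower_l; lra.
Qed.

Lemma Rpower_succ x a : 0 < x -> Rpower x a = Rpower x (a - 1) * x.
Proof.
  intros Hx. rewrite <- (Rpower_1 x Hx) at 3. rewrite <- Rpower_plus. f_equal. ring.
Qed.

(** Mean value theorem, with x^(q-1) <= M^(q-1) because q >= 1. A left endpoint 0 is treated apart,
    since [Rpower] is differentiated only at positive arguments; there b^q = b^(q-1) b is enough. *)
Lemma rpow_Lipschitz q M a b :
  1 <= q -> 0 < M -> 0 <= a <= M -> 0 <= b <= M ->
  Rabs (rpow a q - rpow b q) <= q * Rpower M (q - 1) * Rabs (a - b).
Proof.
  intros Hq HM.
  assert (G : forall a b, 0 <= a -> a < b -> b <= M ->
      rpow b q - rpow a q <= q * Rpower M (q - 1) * (b - a)).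
  { clear a b. intros a b Ha Hab Hb.
    destruct (Req_dec a 0) as [->|Ha0].
    - unfold rpow at 2. destruct (Req_EM_T 0 0) as [_|]; [|lra].
      rewrite rpow_pos_eq, Rpower_succ by lra.
      assert (Rpower b (q - 1) <= Rpower M (q - 1)) by (apply Rle_Rpower_l; lra).
      rewrite !Rminus_0_r. apply Rmult_le_compat_r; [lra|].
      pose proof (Rpower_nonneg M (q - 1)). nra.
    - rewrite !rpow_pos_eq by lra.
      destruct (MVT_cor2 (fun x => Rpower x q) (fun x => q * Rpower x (q - 1)) a b Hab)
        as (c & Hc & Hac).
      + intros c Hc. apply derivable_pt_lim_power. lra.
      + cbv beta in Hc. rewrite Hc. apply Rmult_le_compat_r; [lra|]. apply Rmult_le_compat_l; [lra|].
        apply Rle_Rpower_l; lra. }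
  intros Ha Hb. destruct (Rtotal_order a b) as [H|[->|H]].
  - rewrite Rabs_minus_sym, (Rabs_minus_sym a), (Rabs_pos_eq (b - a)) by lra.
    rewrite Rabs_pos_eq.
    + apply G; lra.
    + assert (rpow a q <= rpow b q) by (apply rpow_le; lra). lra.
  - rewrite !Rminus_diag, Rabs_R0. lra.
  - rewrite (Rabs_pos_eq (a - b)) by lra.
    rewrite Rabs_pos_eq.
    + apply G; lra.
    + assert (rpow b q <= rpow a q) by (apply rpow_le; lra). lra.
Qed.

Lemma Rabs_Cmod_minus (z w : C) : Rabs (Cmod z - Cmod w) <= Cmod (z - w).
Proof.
  pose proof (Cmod_triangle (z - w) w) as H1.
  pose proof (Cmod_triangle (- (z - w)) z) as H2. rewrite Cmod_opp in H2.
  replace (z - w + w)%C with z in H1 by ring.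
  replace (- (z - w) + z)%C with w in H2 by ring.
  apply Rabs_le. lra.
Qed.

(** The forcing without kappa Delta zeta: the part estimated in norm, whereas kappa Delta zeta is
    integrated exactly. *)
Definition gauged_nonlinearity (mu q0 p : R) (zeta v : Z -> C) (n : Z) : C :=
  (RtoC (/ 2 * mu * rpow (Cmod (v n + zeta n)) (2 * p))
     * (v (n + 1)%Z + zeta (n + 1)%Z + v (n - 1)%Z + zeta (n - 1)%Z)
   - RtoC (mu * rpow q0 (2 * p)) * (v n + zeta n))%C.

Lemma forcing_split kappa mu q0 p zeta v n :
  forcing kappa mu q0 p zeta v n
  = (RtoC kappa * Delta zeta n + gauged_nonlinearity mu q0 p zeta v n)%C.
Proof. unfold forcing, gauged_nonlinearity. ring. Qed.

(** The difference splits in three. The gauge term gives q0^(2p); the change at the two neighbours,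
    weighted 1/2 each and controlled by shift invariance, gives M^(2p); the change of the power
    gives 2p M^(2p-1) times half a neighbour sum of size 2M. The last two add up to (2p+1)
    M^(2p). *)
Lemma nonlinearity_Lipschitz mu q0 p zeta M v v' d :
  1 <= p -> 0 < M ->
  (forall n, Cmod (v n + zeta n) <= M) -> (forall n, Cmod (v' n + zeta n) <= M) ->
  l2_le (fun n => (v n - v' n)%C) d ->
  l2_le (fun n => (gauged_nonlinearity mu q0 p zeta v n
                   - gauged_nonlinearity mu q0 p zeta v' n)%C)
    (Rabs mu * (rpow q0 (2 * p) + (2 * p + 1) * rpow M (2 * p)) * d).
Proof.
  intros Hp HM Hv Hv' Hd. pose proof (Rabs_pos mu) as Hmu.
  set (a := fun n => rpow (Cmod (v n + zeta n)) (2 * p)).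
  set (b := fun n => rpow (Cmod (v' n + zeta n)) (2 * p)).
  set (Mq := rpow M (2 * p)). set (Q := rpow q0 (2 * p)).
  assert (HMq : 0 <= Mq) by apply rpow_nonneg.
  assert (HQ : 0 <= Q) by apply rpow_nonneg.
  assert (Ha : forall n, 0 <= a n <= Mq).
  { intros n. split; [apply rpow_nonneg|]. apply rpow_le; [lra|].
    split; [apply Cmod_ge_0|apply Hv]. }
  assert (H1 : l2_le (fun n => (RtoC (- (mu * Q)) * (v n - v' n))%C) (Rabs mu * Q * d)).
  { eapply l2_le_dom; [| |exact Hd]; [now apply Rmult_le_pos|].
    intros n. rewrite Cmod_mult, Cmod_R, Rabs_Ropp, Rabs_mult, (Rabs_pos_eq Q HQ). lra. }
  assert (H2 : forall m, l2_le (fun n => (RtoC (/ 2 * mu * a n) * (v (n + m)%Z - v' (n + m)%Z))%C)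
      (/ 2 * Rabs mu * Mq * d)).
  { intros m. eapply l2_le_dom; [| |exact (l2_le_shift _ m _ Hd)].
    - apply Rmult_le_pos; [lra|exact HMq].
    - intros n. rewrite Cmod_mult, Cmod_R, !Rabs_mult.
      rewrite (Rabs_pos_eq (/ 2)) by lra. rewrite (Rabs_pos_eq (a n)) by apply Ha.
      apply Rmult_le_compat_r; [apply Cmod_ge_0|].
      apply Rmult_le_compat_l; [lra|apply Ha]. }
  assert (H3 : l2_le (fun n => (RtoC (/ 2 * mu * (a n - b n))
        * (v' (n + 1)%Z + zeta (n + 1)%Z + (v' (n - 1)%Z + zeta (n - 1)%Z)))%C)
      (Rabs mu * (2 * p * Mq) * d)).
  { eapply l2_le_dom; [| |exact Hd].
    - apply Rmult_le_pos; [lra|]. apply Rmult_le_pos; lra.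
    - intros n. rewrite Cmod_mult, Cmod_R, !Rabs_mult, (Rabs_pos_eq (/ 2)) by lra.
      assert (Hab : Rabs (a n - b n) <= 2 * p * Rpower M (2 * p - 1) * Cmod (v n - v' n)).
      { eapply Rle_trans; [apply (rpow_Lipschitz (2 * p) M)|]; try lra.
        - split; [apply Cmod_ge_0|apply Hv].
        - split; [apply Cmod_ge_0|apply Hv'].
        - apply Rmult_le_compat_l.
          + apply Rmult_le_pos; [lra|apply Rpower_nonneg].
          + eapply Rle_trans; [apply Rabs_Cmod_minus|]. right. f_equal. ring. }
      assert (HS : Cmod (v' (n + 1)%Z + zeta (n + 1)%Z + (v' (n - 1)%Z + zeta (n - 1)%Z)) <= 2 * M).
      { eapply Rle_trans; [apply Cmod_triangle|].
        pose proof (Hv' (n + 1)%Z). pose proof (Hv' (n - 1)%Z). lra. }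
      unfold Mq. rewrite rpow_pos_eq, Rpower_succ by exact HM.
      set (P := Rpower M (2 * p - 1)) in *.
      apply Rle_trans with (/ 2 * Rabs mu * (2 * p * P * Cmod (v n - v' n)) * (2 * M)).
      + apply Rmult_le_compat; try exact HS; try apply Cmod_ge_0.
        * apply Rmult_le_pos; [lra|apply Rabs_pos].
        * apply Rmult_le_compat_l; [lra|exact Hab].
      + right. field. }
  pose proof (l2_le_plus _ _ _ _ (l2_le_plus _ _ _ _ H1 (l2_le_plus _ _ _ _ (H2 1%Z) (H2 (-1)%Z))) H3)
    as H.
  eapply l2_le_weaken; [eapply l2_le_ext; [|exact H]|].
  - intros n. unfold gauged_nonlinearity. fold (a n) (b n) Q.
    replace (n + -1)%Z with (n - 1)%Z by lia.
    rewrite RtoC_opp, !RtoC_mult, RtoC_minus. ring.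
  - right. field.
Qed.

(** Up to the factor mu, the nonlinearity at zero is (|zeta_n|^(2p) - q0^(2p)) (zeta_(n+1) +
    zeta_(n-1)) / 2 + q0^(2p) (Delta zeta)_n / 2. The defect |zeta| - q0 makes the first term square
    summable, and zeta'' the second. *)
Lemma nonlinearity_background_l2 mu q0 p zeta Z0 D0 S0 :
  1 <= p -> 0 < q0 -> (forall n, Cmod (zeta n) <= Z0) ->
  l2_le (abs_defect q0 zeta) D0 -> l2_le (diff (diff zeta)) S0 ->
  l2_le (gauged_nonlinearity mu q0 p zeta (fun _ => RtoC 0))
    (Rabs mu * (2 * p * rpow (Z0 + q0 + D0) (2 * p + 1) + rpow q0 (2 * p) * S0)).
Proof.
  intros Hp Hq HZ HD HS. pose proof (Rabs_pos mu) as Hmu.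
  pose proof (l2_le_pos _ _ HD) as HD0. pose proof (l2_le_pos _ _ HS) as HS0.
  assert (HZ0 : 0 <= Z0) by (eapply Rle_trans; [apply Cmod_ge_0|apply (HZ 0%Z)]).
  (* [A] dominates |zeta_n| and q0, as [rpow_Lipschitz] requires, and also [D0], so that A^(2p-1) Z0
     D0 <= A^(2p+1); this is the power found in the radius. *)
  set (A := Z0 + q0 + D0). assert (HA : 0 < A) by (unfold A; lra).
  set (Q := rpow q0 (2 * p)). assert (HQ : 0 <= Q) by apply rpow_nonneg.
  set (a := fun n => rpow (Cmod (zeta n)) (2 * p)).
  set (P := Rpower A (2 * p - 1)). assert (HP : 0 <= P) by apply Rpower_nonneg.
  assert (H1 : l2_le (fun n => (RtoC (/ 2 * mu * Q) * Delta zeta n)%C) (Rabs mu * Q * S0)).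
  { eapply l2_le_dom; [| |exact (l2_le_shift _ 1%Z _ HS)].
    - now apply Rmult_le_pos.
    - intros n. rewrite Delta_diff, Cmod_mult, Cmod_R, !Rabs_mult.
      rewrite (Rabs_pos_eq (/ 2)), (Rabs_pos_eq Q) by lra.
      apply Rmult_le_compat_r; [apply Cmod_ge_0|].
      assert (0 <= Rabs mu * Q) by now apply Rmult_le_pos. lra. }
  assert (H2 : l2_le (fun n => (RtoC (/ 2 * mu * (a n - Q))
        * (zeta (n + 1)%Z + zeta (n - 1)%Z))%C) (Rabs mu * (2 * p * P * Z0) * D0)).
  { eapply l2_le_dom; [| |exact HD].
    - apply Rmult_le_pos; [lra|]. repeat apply Rmult_le_pos; lra.
    - intros n. rewrite Cmod_mult, Cmod_R, !Rabs_mult, (Rabs_pos_eq (/ 2)) by lra.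
      unfold abs_defect. rewrite Cmod_R.
      assert (Hab : Rabs (a n - Q) <= 2 * p * P * Rabs (Cmod (zeta n) - q0)).
      { apply rpow_Lipschitz; try lra.
        - split; [apply Cmod_ge_0|]. specialize (HZ n). unfold A. lra.
        - unfold A; lra. }
      assert (HS' : Cmod (zeta (n + 1)%Z + zeta (n - 1)%Z) <= 2 * Z0).
      { eapply Rle_trans; [apply Cmod_triangle|].
        pose proof (HZ (n + 1)%Z). pose proof (HZ (n - 1)%Z). lra. }
      apply Rle_trans with (/ 2 * Rabs mu * (2 * p * P * Rabs (Cmod (zeta n) - q0)) * (2 * Z0)).
      + apply Rmult_le_compat; try exact HS'; try apply Cmod_ge_0.
        * apply Rmult_le_pos; [lra|apply Rabs_pos].
        * apply Rmult_le_compat_l; [lra|exact Hab].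
      + right. field. }
  eapply l2_le_weaken; [eapply l2_le_ext; [|exact (l2_le_plus _ _ _ _ H2 H1)]|].
  - intros n. unfold gauged_nonlinearity. rewrite !Cplus_0_l. fold (a n) Q.
    unfold Delta. rewrite !RtoC_mult, RtoC_minus.
    assert (E : (RtoC (/ 2) * RtoC 2)%C = 1%C) by (rewrite <- RtoC_mult; f_equal; field).
    transitivity (RtoC (/ 2) * RtoC mu * RtoC (a n) * (zeta (n + 1)%Z + zeta (n - 1)%Z)
      - (RtoC (/ 2) * RtoC 2) * RtoC mu * RtoC Q * zeta n)%C; [ring|rewrite E; ring].
  - rewrite (rpow_pos_eq A) by exact HA.
    rewrite Rpower_succ by exact HA. replace (2 * p + 1 - 1) with (2 * p) by ring.
    rewrite Rpower_succ by exact HA. fold P.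
    assert (Z0 * D0 <= A * A) by (apply Rmult_le_compat; unfold A; lra).
    apply Rle_trans with (Rabs mu * (2 * p * P * (Z0 * D0) + Q * S0)); [right; ring|].
    apply Rmult_le_compat_l; [exact Hmu|]. apply Rplus_le_compat_r.
    rewrite !Rmult_assoc. rewrite <- !Rmult_assoc, (Rmult_assoc _ A A), (Rmult_assoc _ Z0 D0).
    apply Rmult_le_compat_l; [|assumption]. repeat apply Rmult_le_pos; lra.
Qed.

(** * Duhamel's integral *)

(** A total function, so that Duhamel's integral is a sequence over the sites without choosing
    witnesses; [is_CInt_CInt] identifies its value once the integral exists. *)
Definition CInt (f : R -> C) (a b : R) : C :=
  (RInt (fun s => Re (f s)) a b, RInt (fun s => Im (f s)) a b).

Lemma is_CInt_CInt f a b I : is_CInt f a b I -> CInt f a b = I.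
Proof.
  rewrite is_CInt_parts. intros [H1 H2]. unfold CInt.
  rewrite (is_RInt_unique _ _ _ _ H1), (is_RInt_unique _ _ _ _ H2). now destruct I.
Qed.

Lemma is_CInt_minus f g a b I J :
  is_CInt f a b I -> is_CInt g a b J -> is_CInt (fun s => (f s - g s)%C) a b (I - J)%C.
Proof. exact (is_RInt_minus (V := C_R_NormedModule) f g a b I J). Qed.

Lemma is_CInt_plus f g a b I J :
  is_CInt f a b I -> is_CInt g a b J -> is_CInt (fun s => (f s + g s)%C) a b (I + J)%C.
Proof. exact (is_RInt_plus (V := C_R_NormedModule) f g a b I J). Qed.

Lemma is_CInt_Chasles f a b c I J :
  is_CInt f a b I -> is_CInt f b c J -> is_CInt f a c (I + J)%C.
Proof. exact (is_RInt_Chasles (V := C_R_NormedModule) f a b c I J). Qed.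

Lemma is_CInt_ext f g a b I :
  a <= b -> (forall s, a < s < b -> f s = g s) -> is_CInt f a b I -> is_CInt g a b I.
Proof.
  intros Hab E. apply (is_RInt_ext (V := C_R_NormedModule)).
  rewrite Rmin_left, Rmax_right by exact Hab. exact E.
Qed.

Lemma Lipschitz_continuous (f : R -> R) K x :
  (forall s s', Rabs (f s - f s') <= K * Rabs (s - s')) -> continuous f x.
Proof.
  intros H. apply filterlim_locally. intros eps.
  (* Nothing makes [K] positive; the maximum with 1 can be divided by. *)
  set (K' := Rmax K 1). assert (HK : 0 < K') by (unfold K'; pose proof (Rmax_r K 1); lra).
  assert (Hd : 0 < eps / K') by (apply Rdiv_lt_0_compat; [apply eps|exact HK]).
  exists (mkposreal _ Hd). intros y Hy.
  unfold ball in *; simpl in *. unfold AbsRing_ball, abs, minus, plus, opp in *; simpl in *.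
  eapply Rle_lt_trans; [apply H|].
  apply Rle_lt_trans with (K' * Rabs (y - x)).
  - apply Rmult_le_compat_r; [apply Rabs_pos|apply Rmax_l].
  - replace (pos eps) with (K' * (eps / K')) by (field; lra).
    apply Rmult_lt_compat_l; [exact HK|exact Hy].
Qed.

Lemma CInt_exists_Lipschitz (f : R -> C) K a b :
  (forall s s', Cmod (f s - f s') <= K * Rabs (s - s')) -> is_CInt f a b (CInt f a b).
Proof.
  intros H. apply is_CInt_parts. split; simpl;
    apply (RInt_correct (V := R_CompleteNormedModule)),
      (ex_RInt_continuous (V := R_CompleteNormedModule)); intros x _;
    apply (Lipschitz_continuous _ K); intros s s'; (eapply Rle_trans; [|apply H]).
  - apply (re_le_Cmod (f s - f s')).
  - apply (im_le_Cmod (f s - f s')).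
Qed.

Lemma propagator_minus kappa t u v n :
  in_linf u -> in_linf v ->
  propagator kappa t (fun m => (u m - v m)%C) n
  = (propagator kappa t u n - propagator kappa t v n)%C.
Proof.
  intros Hu Hv.
  replace (fun m => (u m - v m)%C) with (fun m => (u m + (-(1)) * v m)%C)
    by (apply functional_extensionality; intros; ring).
  rewrite propagator_plus, (propagator_scal kappa t (-(1))%C v);
    [ring|exact Hv|exact Hu|now apply in_linf_scal].
Qed.

(** Insert U(b) u: one difference changes only the time, the other only the datum, where
    contractivity applies. *)
Lemma duhamel_integrand_Lipschitz kappa a b u v B d :
  0 <= kappa -> 0 <= a -> 0 <= b -> l2_le u B -> l2_le v B ->
  l2_le (fun n => (u n - v n)%C) d ->
  forall n, Cmod (propagator kappa a u n - propagator kappa b v n)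
    <= Rabs (a - b) * (kappa * (4 * B)) + d.
Proof.
  intros Hk Ha Hb Hu Hv Hd n.
  pose proof (l2_le_linf _ _ Hu) as Lu. pose proof (l2_le_linf _ _ Hv) as Lv.
  replace (propagator kappa a u n - propagator kappa b v n)%C
    with ((propagator kappa a u n - propagator kappa b u n)
       + propagator kappa b (fun m => (u m - v m)%C) n)%C
    by (rewrite propagator_minus by assumption; ring).
  eapply Rle_trans; [apply Cmod_triangle|]. apply Rplus_le_compat.
  - destruct (Rle_dec a b) as [Hab|Hab].
    + rewrite Rabs_minus_sym, Rabs_pos_eq by lra.
      refine (l2_le_site (fun n => (propagator kappa a u n - propagator kappa b u n)%C) _ n _).
      apply l2_le_minus_sym. apply propagator_l2_Lipschitz; auto.
    + rewrite Rabs_pos_eq by lra.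
      refine (l2_le_site (fun n => (propagator kappa a u n - propagator kappa b u n)%C) _ n _).
      apply propagator_l2_Lipschitz; auto. lra.
  - refine (l2_le_site _ _ n _). apply propagator_l2_contraction; assumption.
Qed.

Definition duhamel_integral (kappa : R) (F : R -> Z -> C) (t : R) (n : Z) : C :=
  CInt (fun s => propagator kappa (t - s) (F s) n) 0 t.

(** Demanded at all real times and not only on [0,T], which keeps endpoint conditions out of the
    continuity arguments; the paths built later are extended by [clamp]. *)
Definition l2_Lipschitz (F : R -> Z -> C) (K : R) : Prop :=
  forall s s', l2_le (fun n => (F s n - F s' n)%C) (K * Rabs (s - s')).

(* The integrand is only controlled for [s <= t], whence the truncation [Rmax 0 (t - s)]. *)
Lemma duhamel_integral_exists kappa F B K t a b n :
  0 <= kappa -> a <= b <= t ->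
  (forall s, l2_le (F s) B) -> l2_Lipschitz F K ->
  is_CInt (fun s => propagator kappa (t - s) (F s) n) a b
    (CInt (fun s => propagator kappa (t - s) (F s) n) a b).
Proof.
  intros Hk Hab HB HK. pose proof (l2_le_pos _ _ (HB 0)) as HB0.
  set (f := fun s => propagator kappa (Rmax 0 (t - s)) (F s) n).
  assert (Hf : is_CInt f a b (CInt f a b)).
  { apply (CInt_exists_Lipschitz f (kappa * (4 * B) + K)). intros s s'.
    eapply Rle_trans; [apply (duhamel_integrand_Lipschitz kappa _ _ _ _ B (K * Rabs (s - s')));
      auto using Rmax_l|].
    assert (Rabs (Rmax 0 (t - s) - Rmax 0 (t - s')) <= Rabs (s - s')).
    { unfold Rmax. repeat destruct Rle_dec; unfold Rabs; repeat destruct Rcase_abs; lra. }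
    assert (0 <= kappa * (4 * B)) by (apply Rmult_le_pos; lra). nra. }
  assert (Hg : is_CInt (fun s => propagator kappa (t - s) (F s) n) a b (CInt f a b)).
  { eapply is_CInt_ext; [| |exact Hf]; [lra|]. intros s Hs. unfold f.
    now rewrite Rmax_right by lra. }
  now rewrite (is_CInt_CInt _ _ _ _ Hg).
Qed.

Lemma duhamel_integral_l2 kappa F B t a b I :
  0 <= kappa -> a <= b <= t -> 0 <= B ->
  (forall s, a < s < b -> l2_le (F s) B) ->
  (forall n, is_CInt (fun s => propagator kappa (t - s) (F s) n) a b (I n)) ->
  l2_le I ((b - a) * B).
Proof.
  intros Hk Hab HB HF HI.
  apply (l2_le_CInt (fun s => propagator kappa (t - s) (F s))); [lra|exact HB|exact HI|].
  intros s Hs. apply propagator_l2_contraction; [exact Hk|lra|now apply HF].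
Qed.

(** Split the later integral at [t1]: over [0,t1] only the propagation time changes, by t2 - t1, and
    what remains is an integral over [t1,t2]. The constant does not involve [K]. *)
Lemma duhamel_integral_time_Lipschitz kappa F B K t1 t2 :
  0 <= kappa -> 0 <= t1 <= t2 ->
  (forall s, l2_le (F s) B) -> l2_Lipschitz F K ->
  l2_le (fun n => (duhamel_integral kappa F t2 n - duhamel_integral kappa F t1 n)%C)
    ((t2 - t1) * (t1 * (kappa * (4 * B)) + B)).
Proof.
  intros Hk Ht HB HK. pose proof (l2_le_pos _ _ (HB 0)) as HB0.
  set (J1 := fun n => CInt (fun s => propagator kappa (t2 - s) (F s) n) 0 t1).
  set (J2 := fun n => CInt (fun s => propagator kappa (t2 - s) (F s) n) t1 t2).
  set (I1 := duhamel_integral kappa F t1).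
  assert (HJ1 : forall n, is_CInt (fun s => propagator kappa (t2 - s) (F s) n) 0 t1 (J1 n))
    by (intros n; apply (duhamel_integral_exists kappa F B K); auto; lra).
  assert (HJ2 : forall n, is_CInt (fun s => propagator kappa (t2 - s) (F s) n) t1 t2 (J2 n))
    by (intros n; apply (duhamel_integral_exists kappa F B K); auto; lra).
  assert (HI1 : forall n, is_CInt (fun s => propagator kappa (t1 - s) (F s) n) 0 t1 (I1 n))
    by (intros n; apply (duhamel_integral_exists kappa F B K); auto; lra).
  apply (l2_le_ext (fun n => ((J1 n - I1 n) + J2 n)%C)).
  { intros n. unfold duhamel_integral at 1.
    rewrite (is_CInt_CInt _ _ _ _ (is_CInt_Chasles _ _ _ _ _ _ (HJ1 n) (HJ2 n))).
    fold I1. ring. }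
  replace ((t2 - t1) * (t1 * (kappa * (4 * B)) + B))
    with ((t1 - 0) * ((t2 - t1) * (kappa * (4 * B))) + (t2 - t1) * B) by ring.
  apply l2_le_plus.
  - apply (l2_le_CInt (fun s n => (propagator kappa (t2 - s) (F s) n
        - propagator kappa (t1 - s) (F s) n)%C)); [lra| | |].
    + repeat apply Rmult_le_pos; lra.
    + intros n. exact (is_CInt_minus _ _ _ _ _ _ (HJ1 n) (HI1 n)).
    + intros s Hs. replace (t2 - t1) with ((t2 - s) - (t1 - s)) by ring.
      apply propagator_l2_Lipschitz; [exact Hk|lra|apply HB].
  - apply (duhamel_integral_l2 kappa F B t2 t1 t2); auto; lra.
Qed.

(** * Sitewise limits of complex sequences *)

Definition Cseq_lim (z : nat -> C) (l : C) : Prop :=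
  is_lim_seq (fun k => Re (z k)) (Re l) /\ is_lim_seq (fun k => Im (z k)) (Im l).

Lemma Cseq_lim_Cmod z l : Cseq_lim z l -> is_lim_seq (fun k => Cmod (z k)) (Cmod l).
Proof.
  intros [H1 H2].
  apply (is_lim_seq_ext (fun k => Cmod (Re (z k), Im (z k)))).
  - intros k. now destruct (z k).
  - pose proof (is_lim_seq_Cmod _ _ _ _ H1 H2) as H. now destruct l.
Qed.

Lemma Cseq_lim_minus z w l m :
  Cseq_lim z l -> Cseq_lim w m -> Cseq_lim (fun k => (z k - w k)%C) (l - m)%C.
Proof.
  intros [H1 H2] [H3 H4].
  split; [exact (is_lim_seq_minus' _ _ _ _ H1 H3)|exact (is_lim_seq_minus' _ _ _ _ H2 H4)].
Qed.

Lemma Cseq_lim_const c : Cseq_lim (fun _ => c) c.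
Proof. split; apply is_lim_seq_const. Qed.

Lemma is_lim_seq_half_pow c : is_lim_seq (fun k => c * (/ 2) ^ k) 0.
Proof.
  replace (Finite 0) with (Rbar_mult c 0) by (simpl; f_equal; ring).
  apply is_lim_seq_scal_l, is_lim_seq_geom. rewrite Rabs_pos_eq; lra.
Qed.

(** The limit is written with [Lim_seq] to be an explicit function of the sequence, from which a
    path can be defined without a choice principle. *)
Lemma geometric_Cauchy_Cseq_lim (z : nat -> C) c :
  (forall k m, Cmod (z (k + m)%nat - z k) <= c * (/ 2) ^ k) ->
  Cseq_lim z (real (Lim_seq (fun k => Re (z k))), real (Lim_seq (fun k => Im (z k)))).
Proof.
  intros H.
  assert (G : forall a : nat -> R,
     (forall k m, Rabs (a (k + m)%nat - a k) <= c * (/ 2) ^ k) ->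
     is_lim_seq a (real (Lim_seq a))).
  { intros a Ha.
    assert (Hex : ex_finite_lim_seq a).
    { apply ex_lim_seq_cauchy_corr. intros eps.
      destruct (proj2 (is_lim_seq_spec _ 0) (is_lim_seq_half_pow c)
        (mkposreal _ (is_pos_div_2 eps))) as [N HN].
      exists N. intros n m Hn Hm.
      assert (Hj : forall j, (N <= j)%nat -> Rabs (a j - a N) < eps / 2).
      { intros j Hj. replace j with (N + (j - N))%nat by lia.
        eapply Rle_lt_trans; [apply Ha|].
        eapply Rle_lt_trans; [apply Rle_abs|].
        specialize (HN N (le_n N)). now rewrite Rminus_0_r in HN. }
      replace (a n - a m) with ((a n - a N) - (a m - a N)) by ring.
      eapply Rle_lt_trans; [apply Rabs_triang|]. rewrite Rabs_Ropp.
      pose proof (Hj n Hn). pose proof (Hj m Hm). lra. }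
    now apply Lim_seq_correct'. }
  split; apply G; intros k m; (eapply Rle_trans; [|apply (H k m)]).
  - apply (re_le_Cmod (z (k + m)%nat - z k)).
  - apply (im_le_Cmod (z (k + m)%nat - z k)).
Qed.

(** * Fixed point and stability *)

(** Integrability at each site is the only regularity in time asked of [F] and [G], because the
    stability estimate applies this to arbitrary solutions. The bound [B] makes the propagator
    linear on their values. *)
Lemma duhamel_difference_l2 kappa F G B e t I J :
  0 <= kappa -> 0 <= t -> 0 <= e ->
  (forall s, 0 <= s <= t -> l2_le (F s) B) -> (forall s, 0 <= s <= t -> l2_le (G s) B) ->
  (forall s, 0 <= s <= t -> l2_le (fun n => (F s n - G s n)%C) e) ->
  (forall n, is_CInt (fun s => propagator kappa (t - s) (F s) n) 0 t (I n)) ->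
  (forall n, is_CInt (fun s => propagator kappa (t - s) (G s) n) 0 t (J n)) ->
  l2_le (fun n => (I n - J n)%C) (t * e).
Proof.
  intros Hk Ht He HF HG HD HI HJ. replace t with (t - 0) at 1 by ring.
  apply (duhamel_integral_l2 kappa (fun s n => (F s n - G s n)%C) e t 0 t); auto; try lra.
  - intros s Hs. apply HD. lra.
  - intros n. eapply is_CInt_ext; [exact Ht| |exact (is_CInt_minus _ _ _ _ _ _ (HI n) (HJ n))].
    intros s Hs. cbv beta. rewrite propagator_minus; [reflexivity| |].
    + apply l2_le_linf with B, HF. lra.
    + apply l2_le_linf with B, HG. lra.
Qed.

Definition duhamel_map (kappa : R) (N : (Z -> C) -> Z -> C) (phi0 : Z -> C)
    (phi : R -> Z -> C) (t : R) (n : Z) : C :=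
  (propagator kappa t phi0 n + Ci * duhamel_integral kappa (fun s => N (phi s)) t n)%C.

(** Extends paths beyond [0,T] by freezing them at the ends; being 1-Lipschitz, it preserves
    Lipschitz constants in time. *)
Definition clamp (T t : R) : R := Rmax 0 (Rmin t T).

Lemma clamp_bounds T t : 0 <= T -> 0 <= clamp T t <= T.
Proof. intros H. unfold clamp, Rmax, Rmin. repeat destruct Rle_dec; lra. Qed.

Lemma clamp_id T t : 0 <= t <= T -> clamp T t = t.
Proof. intros H. unfold clamp, Rmax, Rmin. repeat destruct Rle_dec; lra. Qed.

Lemma clamp_Lipschitz T s t : Rabs (clamp T s - clamp T t) <= Rabs (s - t).
Proof.
  unfold clamp, Rmax, Rmin. repeat destruct Rle_dec; unfold Rabs;
    repeat destruct Rcase_abs; lra.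
Qed.

Lemma l2_le_scal_Ci u B : l2_le u B -> l2_le (fun n => (Ci * u n)%C) B.
Proof. apply l2_le_dom1. intros n. rewrite Cmod_mult, Cmod_Ci. lra. Qed.

Lemma half_pow_vanish x c : (forall k, x <= c * (/ 2) ^ k) -> x <= 0.
Proof.
  intros H. exact (is_lim_seq_le (fun _ => x) _ (Finite x) (Finite 0) H
    (is_lim_seq_const x) (is_lim_seq_half_pow c)).
Qed.

Definition ball_bounded (N : (Z -> C) -> Z -> C) (r B : R) : Prop :=
  forall v, l2_le v r -> l2_le (N v) B.

Definition ball_Lipschitz (N : (Z -> C) -> Z -> C) (r L : R) : Prop :=
  forall v v' d, l2_le v r -> l2_le v' r -> l2_le (fun n => (v n - v' n)%C) d ->
    l2_le (fun n => (N v n - N v' n)%C) (L * d).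

(** The terms U(t) phi0 cancel, and the integral over [0,t] of contractions applied to differences
    of size L d is at most t L d <= d/2. *)
Lemma duhamel_map_contraction kappa T r L B N phi0 phi psi K K' d t :
  0 <= kappa -> 0 <= L -> L * T <= / 2 -> ball_bounded N r B -> ball_Lipschitz N r L ->
  (forall s, l2_le (phi s) r) -> l2_Lipschitz phi K ->
  (forall s, l2_le (psi s) r) -> l2_Lipschitz psi K' ->
  (forall s, l2_le (fun n => (phi s n - psi s n)%C) d) -> 0 <= t <= T ->
  l2_le (fun n => (duhamel_map kappa N phi0 phi t n - duhamel_map kappa N phi0 psi t n)%C)
    (d / 2).
Proof.
  intros Hk HL HLT HB HN Hphi HK Hpsi HK' Hd Ht.
  pose proof (l2_le_pos _ _ (Hd 0)) as Hd0.
  assert (HLip : forall chi K, (forall s, l2_le (chi s) r) -> l2_Lipschitz chi K ->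
      l2_Lipschitz (fun s => N (chi s)) (L * K)).
  { intros chi K0 H1 H2 s s'. rewrite Rmult_assoc. apply HN; auto. }
  apply (l2_le_ext (fun n => (Ci * (duhamel_integral kappa (fun s => N (phi s)) t n
     - duhamel_integral kappa (fun s => N (psi s)) t n))%C)).
  { intros n. unfold duhamel_map. ring. }
  apply l2_le_scal_Ci. apply l2_le_weaken with (t * (L * d)).
  - apply (duhamel_difference_l2 kappa (fun s => N (phi s)) (fun s => N (psi s)) B); auto;
      try lra.
    + now apply Rmult_le_pos.
    + intros n. apply (duhamel_integral_exists kappa _ B (L * K)); auto. lra.
    + intros n. apply (duhamel_integral_exists kappa _ B (L * K')); auto. lra.
  - assert (t * L <= / 2) by nra. nra.
Qed.

(** The constant is free of the Lipschitz constant [K] of the argument; this makes the Picard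
    iterates equi-Lipschitz in time. *)
Lemma duhamel_map_time_Lipschitz kappa T r L B N phi0 A0 phi K :
  0 <= kappa -> 0 <= T -> 0 <= L -> ball_bounded N r B -> ball_Lipschitz N r L ->
  l2_le phi0 A0 -> (forall s, l2_le (phi s) r) -> l2_Lipschitz phi K ->
  l2_Lipschitz (fun t => duhamel_map kappa N phi0 phi (clamp T t))
    (kappa * (4 * A0) + (T * (kappa * (4 * B)) + B)).
Proof.
  intros Hk HT HL HB HN H0 Hphi HK.
  pose proof (l2_le_pos _ _ (HB _ (Hphi 0))) as HB0. pose proof (l2_le_pos _ _ H0) as HA0.
  assert (HLip : l2_Lipschitz (fun s => N (phi s)) (L * K)).
  { intros s s'. rewrite Rmult_assoc. apply HN; auto. }
  assert (G : forall t1 t2, 0 <= t1 <= t2 -> t2 <= T ->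
     l2_le (fun n => (duhamel_map kappa N phi0 phi t2 n - duhamel_map kappa N phi0 phi t1 n)%C)
       ((t2 - t1) * (kappa * (4 * A0) + (T * (kappa * (4 * B)) + B)))).
  { intros t1 t2 H12 H2.
    apply l2_le_weaken with ((t2 - t1) * (kappa * (4 * A0))
      + (t2 - t1) * (t1 * (kappa * (4 * B)) + B)).
    - apply (l2_le_ext (fun n => ((propagator kappa t2 phi0 n - propagator kappa t1 phi0 n)
        + Ci * (duhamel_integral kappa (fun s => N (phi s)) t2 n
        - duhamel_integral kappa (fun s => N (phi s)) t1 n))%C)).
      { intros n. unfold duhamel_map. ring. }
      apply l2_le_plus; [now apply propagator_l2_Lipschitz|].
      apply l2_le_scal_Ci.
      apply (duhamel_integral_time_Lipschitz kappa (fun s => N (phi s)) B (L * K)); auto.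
    - rewrite <- Rmult_plus_distr_l. apply Rmult_le_compat_l; [lra|].
      apply Rplus_le_compat_l, Rplus_le_compat_r, Rmult_le_compat_r; [|lra].
      apply Rmult_le_pos; lra. }
  set (K1 := kappa * (4 * A0) + (T * (kappa * (4 * B)) + B)) in *.
  assert (HK1 : 0 <= K1).
  { assert (0 <= kappa * (4 * A0)) by (apply Rmult_le_pos; lra).
    assert (0 <= T * (kappa * (4 * B))) by (repeat apply Rmult_le_pos; lra). unfold K1; lra. }
  intros s s'.
  pose proof (clamp_bounds T s HT). pose proof (clamp_bounds T s' HT).
  pose proof (clamp_Lipschitz T s s') as Hc.
  apply l2_le_weaken with (Rabs (clamp T s - clamp T s') * K1).
  - destruct (Rle_dec (clamp T s') (clamp T s)).
    + rewrite Rabs_pos_eq by lra. apply G; lra.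
    + rewrite Rabs_minus_sym, Rabs_pos_eq by lra.
      apply l2_le_minus_sym. apply G; lra.
  - rewrite Rmult_comm. now apply Rmult_le_compat_l.
Qed.

(** Picard iteration from the zero path, with limits taken at each site; [l2_le_lim] hands the ball,
    the time Lipschitz constant and the rate of convergence to the limit. Invariance of the ball is
    a separate hypothesis, as it will come from the exact integration of the background and not from
    [B]. *)
Lemma duhamel_fixed_point kappa T r L B N phi0 A0 :
  0 <= kappa -> 0 <= T -> 0 <= L -> L * T <= / 2 -> 0 <= r ->
  ball_bounded N r B -> ball_Lipschitz N r L -> l2_le phi0 A0 ->
  (forall phi K, (forall s, l2_le (phi s) r) -> l2_Lipschitz phi K ->
     forall t, 0 <= t <= T -> l2_le (duhamel_map kappa N phi0 phi t) r) ->
  exists phi K, (forall s, l2_le (phi s) r) /\ l2_Lipschitz phi K /\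
    forall t n, 0 <= t <= T -> phi t n = duhamel_map kappa N phi0 phi t n.
Proof.
  intros Hk HT HL HLT Hr HB HN H0 Hball.
  set (Phi := fun (phi : R -> Z -> C) t => duhamel_map kappa N phi0 phi (clamp T t)).
  set (K := kappa * (4 * A0) + (T * (kappa * (4 * B)) + B)).
  set (pic := fun k => Nat.iter k Phi (fun _ _ => RtoC 0)).
  assert (Hzero : l2_Lipschitz (fun _ _ => RtoC 0) 0).
  { intros s s'. rewrite Rmult_0_l.
    apply (l2_le_ext (fun _ => RtoC 0)); [intros; ring|apply l2_le_zero]. }
  assert (HPhi : forall phi K0, (forall s, l2_le (phi s) r) -> l2_Lipschitz phi K0 ->
     (forall s, l2_le (Phi phi s) r) /\ l2_Lipschitz (Phi phi) K).
  { intros phi K0 H1 H2. split.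
    - intros s. apply (Hball phi K0 H1 H2). now apply clamp_bounds.
    - exact (duhamel_map_time_Lipschitz kappa T r L B N phi0 A0 phi K0 Hk HT HL HB HN H0 H1 H2). }
  assert (Hpicr : forall k, (forall s, l2_le (pic k s) r) /\ exists K0, l2_Lipschitz (pic k) K0).
  { induction k as [|k [IH1 [K0 IH2]]].
    - split; [|exists 0; exact Hzero].
      intros s. now apply l2_le_weaken with 0; [apply l2_le_zero|].
    - destruct (HPhi _ _ IH1 IH2) as [P1 P2]. split; [exact P1|]. now exists K. }
  assert (HpicS : forall k, l2_Lipschitz (pic (S k)) K).
  { intros k. destruct (Hpicr k) as [H1 [K0 H2]]. exact (proj2 (HPhi _ _ H1 H2)). }
  assert (Hstep : forall k s, l2_le (fun n => (pic (S k) s n - pic k s n)%C) (r * (/ 2) ^ k)).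
  { induction k as [|k IH]; intros s.
    - simpl pow. rewrite Rmult_1_r.
      apply (l2_le_ext (pic 1%nat s)); [intros n; simpl; ring|]. apply (Hpicr 1%nat).
    - replace (r * (/ 2) ^ S k) with (r * (/ 2) ^ k / 2) by (simpl; field).
      destruct (Hpicr k) as [P1 [K1 P2]]. destruct (Hpicr (S k)) as [P3 [K3 P4]].
      exact (duhamel_map_contraction kappa T r L B N phi0 (pic (S k)) (pic k) K3 K1
        (r * (/ 2) ^ k) (clamp T s) Hk HL HLT HB HN P3 P4 P1 P2 IH (clamp_bounds T s HT)). }
  assert (Htail : forall k m s,
     l2_le (fun n => (pic (k + m)%nat s n - pic k s n)%C) (2 * r * (/ 2) ^ k)).
  { intros k m s.
    (* Keeping the subtracted tail makes the geometric sum exact, so the induction on [m] closes. *)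
    apply l2_le_weaken with (2 * r * (/ 2) ^ k - 2 * r * (/ 2) ^ (k + m)).
    - induction m as [|m IH].
      + rewrite Nat.add_0_r, Rminus_diag.
        apply (l2_le_ext (fun _ => RtoC 0)); [intros; ring|apply l2_le_zero].
      + rewrite Nat.add_succ_r.
        apply (l2_le_ext (fun n => ((pic (S (k + m)) s n - pic (k + m)%nat s n)
          + (pic (k + m)%nat s n - pic k s n))%C)); [intros; ring|].
        replace (2 * r * (/ 2) ^ k - 2 * r * (/ 2) ^ S (k + m))
          with (r * (/ 2) ^ (k + m) + (2 * r * (/ 2) ^ k - 2 * r * (/ 2) ^ (k + m)))
          by (simpl; field).
        apply l2_le_plus; [apply Hstep|exact IH].
    - assert (0 <= 2 * r * (/ 2) ^ (k + m))
        by (apply Rmult_le_pos; [lra|apply pow_le; lra]). lra. }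
  set (phi := (fun s n => (real (Lim_seq (fun k => Re (pic k s n))),
                          real (Lim_seq (fun k => Im (pic k s n))))) : R -> Z -> C).
  assert (Hlim : forall s n, Cseq_lim (fun k => pic k s n) (phi s n)).
  { intros s n. apply (geometric_Cauchy_Cseq_lim _ (2 * r)). intros k m.
    exact (l2_le_site _ _ n (Htail k m s)). }
  assert (Hphir : forall s, l2_le (phi s) r).
  { intros s. apply (l2_le_lim (fun k => pic k s) _ (fun _ => r)).
    - intros n. exact (Cseq_lim_Cmod _ _ (Hlim s n)).
    - intros k. apply Hpicr.
    - apply is_lim_seq_const. }
  assert (HphiK : l2_Lipschitz phi K).
  { intros s s'.
    (* Only iterates that are images of the map are known to share the constant [K], hence the index
       [S k]. *)
    apply (l2_le_lim (fun k n => (pic (S k) s n - pic (S k) s' n)%C) _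
      (fun _ => K * Rabs (s - s'))).
    - intros n. pose proof (Cseq_lim_Cmod _ _ (Cseq_lim_minus _ _ _ _ (Hlim s n) (Hlim s' n))) as H.
      now apply is_lim_seq_incr_1 in H.
    - intros k. apply HpicS.
    - apply is_lim_seq_const. }
  assert (Hphid : forall k s, l2_le (fun n => (phi s n - pic k s n)%C) (2 * r * (/ 2) ^ k)).
  { intros k s.
    apply (l2_le_lim (fun m n => (pic (k + m)%nat s n - pic k s n)%C) _
      (fun _ => 2 * r * (/ 2) ^ k)).
    - intros n.
      pose proof (Cseq_lim_Cmod _ _ (Cseq_lim_minus _ _ _ _ (Hlim s n) (Cseq_lim_const (pic k s n)))) as H.
      apply (is_lim_seq_incr_n _ k) in H.
      eapply is_lim_seq_ext; [|exact H]. intros m. cbv beta. now rewrite Nat.add_comm.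
    - intros m. apply Htail.
    - apply is_lim_seq_const. }
  exists phi, K. split; [exact Hphir|]. split; [exact HphiK|].
  intros t n Ht.
  enough (H : Cmod (duhamel_map kappa N phi0 phi t n - phi t n) <= 0).
  { pose proof (Cmod_ge_0 (duhamel_map kappa N phi0 phi t n - phi t n)).
    assert (E : (duhamel_map kappa N phi0 phi t n - phi t n)%C = RtoC 0)
      by (apply Cmod_eq_0; lra).
    replace (duhamel_map kappa N phi0 phi t n)
      with ((duhamel_map kappa N phi0 phi t n - phi t n) + phi t n)%C by ring.
    rewrite E. ring. }
  (* Both the image of [phi] and [phi] itself lie within r 2^(-k) of the iterate [pic (S k)]. *)
  apply (half_pow_vanish _ (2 * r)). intros k.
  destruct (Hpicr k) as [P1 [K1 P2]].
  pose proof (duhamel_map_contraction kappa T r L B N phi0 phi (pic k) K K1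
    (2 * r * (/ 2) ^ k) t Hk HL HLT HB HN Hphir HphiK P1 P2 (Hphid k) Ht) as Hc.
  pose proof (l2_le_minus _ _ _ _ Hc (Hphid (S k) t)) as H.
  replace (2 * r * (/ 2) ^ k / 2 + 2 * r * (/ 2) ^ S k) with (2 * r * (/ 2) ^ k) in H
    by (simpl; field).
  pose proof (l2_le_site _ _ n H) as H'. cbv beta in H'.
  assert (E : pic (S k) t n = duhamel_map kappa N phi0 (pic k) t n).
  { change (duhamel_map kappa N phi0 (pic k) (clamp T t) n
            = duhamel_map kappa N phi0 (pic k) t n). now rewrite clamp_id. }
  rewrite E in H'.
  match type of H' with Cmod ?z <= _ => replace (duhamel_map kappa N phi0 phi t n - phi t n)%C
    with z by ring end.
  exact H'.
Qed.

(** A bound [d] for the difference on all of [0,T] improves to delta + d/2; iterated from the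
    trivial bound 2r, this tends to the fixed point 2 delta. No Gronwall argument and no continuity
    of the norm in time enters. *)
Lemma duhamel_stability kappa T r L B N phi0 psi0 phi psi A0 delta :
  0 <= kappa -> 0 <= L -> L * T <= / 2 -> ball_bounded N r B -> ball_Lipschitz N r L ->
  l2_le phi0 A0 -> l2_le psi0 A0 -> l2_le (fun n => (phi0 n - psi0 n)%C) delta ->
  (forall t, 0 <= t <= T -> l2_le (phi t) r) ->
  (forall t, 0 <= t <= T -> l2_le (psi t) r) ->
  (forall t n, 0 <= t <= T -> exists I,
     is_CInt (fun s => propagator kappa (t - s) (N (phi s)) n) 0 t I /\
     phi t n = (propagator kappa t phi0 n + Ci * I)%C) ->
  (forall t n, 0 <= t <= T -> exists I,
     is_CInt (fun s => propagator kappa (t - s) (N (psi s)) n) 0 t I /\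
     psi t n = (propagator kappa t psi0 n + Ci * I)%C) ->
  forall t, 0 <= t <= T -> l2_le (fun n => (phi t n - psi t n)%C) (2 * delta).
Proof.
  intros Hk HL HLT HB HN H0 H0' Hdelta Hphi Hpsi Dphi Dpsi.
  pose proof (l2_le_pos _ _ Hdelta) as Hd0.
  assert (Hstep : forall d, 0 <= d ->
     (forall t, 0 <= t <= T -> l2_le (fun n => (phi t n - psi t n)%C) d) ->
     forall t, 0 <= t <= T -> l2_le (fun n => (phi t n - psi t n)%C) (delta + d / 2)).
  { intros d Hd IH t Ht.
    set (I := fun n => CInt (fun s => propagator kappa (t - s) (N (phi s)) n) 0 t).
    set (J := fun n => CInt (fun s => propagator kappa (t - s) (N (psi s)) n) 0 t).
    assert (HI : forall n, is_CInt (fun s => propagator kappa (t - s) (N (phi s)) n) 0 t (I n)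
        /\ phi t n = (propagator kappa t phi0 n + Ci * I n)%C).
    { intros n. destruct (Dphi t n Ht) as (I' & H1 & H2).
      unfold I. now rewrite (is_CInt_CInt _ _ _ _ H1). }
    assert (HJ : forall n, is_CInt (fun s => propagator kappa (t - s) (N (psi s)) n) 0 t (J n)
        /\ psi t n = (propagator kappa t psi0 n + Ci * J n)%C).
    { intros n. destruct (Dpsi t n Ht) as (I' & H1 & H2).
      unfold J. now rewrite (is_CInt_CInt _ _ _ _ H1). }
    apply (l2_le_ext (fun n => (propagator kappa t (fun m => (phi0 m - psi0 m)%C) n
       + Ci * (I n - J n))%C)).
    { intros n. rewrite (proj2 (HI n)), (proj2 (HJ n)), propagator_minus;
        [ring|now apply l2_le_linf with A0|now apply l2_le_linf with A0]. }
    apply l2_le_plus; [apply propagator_l2_contraction; tauto|].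
    apply l2_le_scal_Ci. apply l2_le_weaken with (t * (L * d)).
    - apply (duhamel_difference_l2 kappa (fun s => N (phi s)) (fun s => N (psi s)) B); try tauto.
      + now apply Rmult_le_pos.
      + intros s Hs. apply HB, Hphi. lra.
      + intros s Hs. apply HB, Hpsi. lra.
      + intros s Hs. apply HN; [apply Hphi|apply Hpsi|apply IH]; lra.
      + intros n. apply HI.
      + intros n. apply HJ.
    - assert (t * L <= / 2) by nra. nra. }
  intros t Ht. pose proof (l2_le_pos _ _ (Hphi t Ht)) as Hr.
  apply (l2_le_lim (fun _ n => (phi t n - psi t n)%C) _
    (fun k => 2 * delta + 2 * r * (/ 2) ^ k)).
  - intros n. apply is_lim_seq_const.
  - intros k. revert t Ht. induction k as [|k IH]; intros t Ht.
    + apply l2_le_weaken with (r + r); [apply l2_le_minus; auto|simpl; lra].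
    + replace (2 * delta + 2 * r * (/ 2) ^ S k)
        with (delta + (2 * delta + 2 * r * (/ 2) ^ k) / 2) by (simpl; field).
      apply Hstep; auto.
      assert (0 <= 2 * r * (/ 2) ^ k) by (apply Rmult_le_pos; [lra|apply pow_le; lra]). lra.
  - replace (Finite (2 * delta)) with (Finite (2 * delta + 0)) by (f_equal; ring).
    apply is_lim_seq_plus'; [apply is_lim_seq_const|apply is_lim_seq_half_pow].
Qed.

(** * The Cauchy problem *)

(** The bound [M] and the nonempty set of values exclude both infinities, so [real] does not return
    its default. *)
Lemma linf_norm_site u n : in_linf u -> Cmod (u n) <= linf_norm u.
Proof.
  intros [M HM]. unfold linf_norm.
  destruct (Lub_Rbar_correct (fun x => exists n, x = Cmod (u n))) as [Hub Hlub].
  assert (H1 : Rbar_le (Cmod (u n)) (Lub_Rbar (fun x => exists n, x = Cmod (u n))))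
    by (apply Hub; now exists n).
  assert (H2 : Rbar_le (Lub_Rbar (fun x => exists n, x = Cmod (u n))) M)
    by (apply Hlub; intros x [m ->]; apply HM).
  destruct (Lub_Rbar _); simpl in *; [exact H1|destruct H2|destruct H1].
Qed.

Lemma l2_le_lim_at_infty u B : l2_le u B -> lim_at_infty u (RtoC 0) (RtoC 0).
Proof.
  intros H. destruct (l2_le_tends_to_zero u B H) as [H1 H2].
  assert (G : forall v : nat -> C, is_lim_seq (fun k => Cmod (v k)) 0 ->
     filterlim v eventually (locally (RtoC 0))).
  { intros v Hv. apply filterlim_locally. intros eps.
    destruct (proj2 (is_lim_seq_spec _ 0) Hv eps) as [N HN].
    exists N. intros n Hn. specialize (HN n Hn). cbv beta in HN.
    rewrite Rminus_0_r, Rabs_pos_eq in HN by apply Cmod_ge_0.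
    split; unfold ball; simpl; unfold AbsRing_ball, abs, minus, plus, opp; simpl;
      rewrite Ropp_0, Rplus_0_r; (eapply Rle_lt_trans; [|exact HN]).
    - apply re_le_Cmod.
    - apply im_le_Cmod. }
  split; apply G; [|exact H1].
  (* The folded sites are -k-1 while the limit at minus infinity runs over -k, hence a shift by one
     index. *)
  apply is_lim_seq_incr_1. eapply is_lim_seq_ext; [|exact H2].
  intros k. cbv beta. do 2 f_equal. lia.
Qed.

Lemma is_CInt_scal c f a b I :
  is_CInt f a b I -> is_CInt (fun s => (c * f s)%C) a b (c * I)%C.
Proof.
  rewrite !is_CInt_parts. intros [H1 H2]. split.
  - exact (is_RInt_minus (V := R_NormedModule) _ _ _ _ _ _
      (is_RInt_scal (V := R_NormedModule) _ _ _ (Re c) _ H1)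
      (is_RInt_scal (V := R_NormedModule) _ _ _ (Im c) _ H2)).
  - exact (is_RInt_plus (V := R_NormedModule) _ _ _ _ _ _
      (is_RInt_scal (V := R_NormedModule) _ _ _ (Re c) _ H2)
      (is_RInt_scal (V := R_NormedModule) _ _ _ (Im c) _ H1)).
Qed.

Lemma l2_Lipschitz_in_CT T phi r K :
  (forall s, l2_le (phi s) r) -> l2_Lipschitz phi K -> in_CT T phi.
Proof.
  intros Hr HK. split; [intros t _; exact (proj1 (l2_le_in _ _ (Hr t)))|].
  intros t _. apply filterlim_locally. intros eps.
  set (K' := Rmax K 1). assert (HK' : 0 < K') by (unfold K'; pose proof (Rmax_r K 1); lra).
  assert (Hd : 0 < eps / K') by (apply Rdiv_lt_0_compat; [apply eps|exact HK']).
  exists (mkposreal _ Hd). intros s Hs _.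
  unfold ball in *; simpl in *. unfold AbsRing_ball, abs, minus, plus, opp in *; simpl in *.
  rewrite Ropp_0, Rplus_0_r, Rabs_pos_eq by apply sqrt_pos.
  apply Rle_lt_trans with (K * Rabs (s - t)); [exact (proj2 (l2_le_in _ _ (HK s t)))|].
  apply Rle_lt_trans with (K' * Rabs (s - t)).
  - apply Rmult_le_compat_r; [apply Rabs_pos|apply Rmax_l].
  - replace (pos eps) with (K' * (eps / K')) by (field; lra).
    apply Rmult_lt_compat_l; [exact HK'|exact Hs].
Qed.

Lemma CT_norm_le T phi B :
  (forall t, 0 <= t <= T -> l2_le (phi t) B) -> Rbar_le (CT_norm T phi) B.
Proof.
  intros H. apply Lub_Rbar_correct. intros x (t & Ht & ->).
  exact (proj2 (l2_le_in _ _ (H t Ht))).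
Qed.

Lemma in_closed_ball_l2_le T r phi t :
  in_closed_ball T r phi -> 0 <= t <= T -> l2_le (phi t) r.
Proof.
  intros [[Hin _] Hle] Ht. eapply l2_le_weaken; [apply in_l2_le, Hin, Ht|].
  assert (H : Rbar_le (l2_norm (phi t)) (CT_norm T phi))
    by (apply Lub_Rbar_correct; now exists t).
  exact (Rbar_le_trans _ _ _ H Hle).
Qed.

(** * The lifespan condition and bounds for the forcing on the ball *)

Definition lip_const (mu q0 p Z0 r : R) : R :=
  Rabs mu * (rpow q0 (2 * p) + (2 * p + 1) * rpow (r + Z0) (2 * p)).

Lemma lip_const_nonneg mu q0 p Z0 r : 1 <= p -> 0 <= lip_const mu q0 p Z0 r.
Proof.
  intros Hp. unfold lip_const. pose proof (rpow_nonneg q0 (2 * p)).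
  pose proof (rpow_nonneg (r + Z0) (2 * p)).
  apply Rmult_le_pos; [apply Rabs_pos|]. nra.
Qed.

Lemma Rpower_2_ge a b : a <= b -> Rpower 2 a <= Rpower 2 b.
Proof. intros H. apply Rle_Rpower; lra. Qed.

(** The powers of two in the lifespan condition are used only through 2^(7/2) >= 2 and 2^(2p+1/2) >=
    1. *)
Lemma lifespan_lip_const kappa mu q0 p zeta phi0 T :
  1 <= p -> 0 < T -> lifespan_condition kappa mu q0 p zeta phi0 T ->
  lip_const mu q0 p (linf_norm zeta) (rho kappa mu q0 p zeta phi0 T) * T <= / 2.
Proof.
  intros Hp HT H. unfold lifespan_condition in H. unfold lip_const.
  set (Q := rpow q0 (2 * p)) in *.
  set (Mq := rpow (rho kappa mu q0 p zeta phi0 T + linf_norm zeta) (2 * p)) in *.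
  assert (HQ : 0 <= Q) by apply rpow_nonneg. assert (HMq : 0 <= Mq) by apply rpow_nonneg.
  rewrite !(rpow_pos_eq 2) in H by lra.
  assert (H1 : 2 <= Rpower 2 (7 / 2)).
  { rewrite <- (Rpower_1 2) at 1 by lra. apply Rpower_2_ge. lra. }
  assert (H2 : 1 <= Rpower 2 (2 * p + 1 / 2)).
  { rewrite <- (Rpower_O 2) at 1 by lra. apply Rpower_2_ge. lra. }
  set (c1 := Rpower 2 (7 / 2)) in *. set (c2 := Rpower 2 (2 * p + 1 / 2)) in *.
  pose proof (Rabs_pos mu) as Hmu.
  set (Y := Rabs mu * (Q + c2 * (2 * p + 1) * Mq) * T).
  assert (HY : Rabs mu * (Q + (2 * p + 1) * Mq) * T <= Y).
  { apply Rmult_le_compat_r; [lra|]. apply Rmult_le_compat_l; [exact Hmu|].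
    apply Rplus_le_compat_l, Rmult_le_compat_r; [exact HMq|]. nra. }
  assert (HY0 : 0 <= Rabs mu * (Q + (2 * p + 1) * Mq) * T).
  { apply Rmult_le_pos; [|lra]. apply Rmult_le_pos; [exact Hmu|]. nra. }
  replace (c1 * Rabs mu * (Q + c2 * (2 * p + 1) * Mq) * T) with (c1 * Y) in H
    by (unfold Y; ring).
  nra.
Qed.

(** The term kappa Delta zeta cancels in the difference, so the constant is independent of [kappa];
    on the ball |v_n + zeta_n| <= r + Z0. *)
Lemma forcing_ball_Lipschitz kappa mu q0 p zeta Z0 r :
  1 <= p -> 0 <= r -> 0 < Z0 -> (forall n, Cmod (zeta n) <= Z0) ->
  ball_Lipschitz (forcing kappa mu q0 p zeta) r (lip_const mu q0 p Z0 r).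
Proof.
  intros Hp Hr HZ0 HZ v v' d Hv Hv' Hd.
  apply (l2_le_ext (fun n => (gauged_nonlinearity mu q0 p zeta v n
    - gauged_nonlinearity mu q0 p zeta v' n)%C)).
  { intros n. rewrite !forcing_split. ring. }
  apply nonlinearity_Lipschitz; auto; try lra; intros n;
    (eapply Rle_trans; [apply Cmod_triangle|]; apply Rplus_le_compat; [|apply HZ]);
    now apply l2_le_site.
Qed.

Lemma nonlinearity_ball_bounded mu q0 p zeta Z0 r N0 :
  1 <= p -> 0 <= r -> 0 < Z0 -> (forall n, Cmod (zeta n) <= Z0) ->
  l2_le (gauged_nonlinearity mu q0 p zeta (fun _ => RtoC 0)) N0 ->
  ball_bounded (gauged_nonlinearity mu q0 p zeta) r (N0 + lip_const mu q0 p Z0 r * r).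
Proof.
  intros Hp Hr HZ0 HZ HN0 v Hv.
  (* With [kappa = 0] the forcing is the gauged nonlinearity, so the Lipschitz bound for the forcing
     covers the passage from zero to [v]. *)
  apply (l2_le_ext (fun n => (gauged_nonlinearity mu q0 p zeta (fun _ => RtoC 0) n
    + (forcing 0 mu q0 p zeta v n - forcing 0 mu q0 p zeta (fun _ => RtoC 0) n))%C)).
  { intros n. rewrite !forcing_split. ring. }
  apply l2_le_plus; [exact HN0|].
  apply (forcing_ball_Lipschitz 0 mu q0 p zeta Z0 r); auto.
  - eapply l2_le_weaken; [apply l2_le_zero|exact Hr].
  - eapply l2_le_ext; [|exact Hv]. intros n. cbv beta. ring.
Qed.

(** A crude bound that contains kappa ||zeta''||. It serves for the existence of integrals and the
    time Lipschitz constant, whereas the radius rests on the exact integration of the background. *)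
Lemma forcing_ball_bounded kappa mu q0 p zeta Z0 r N0 S0 :
  0 <= kappa -> 1 <= p -> 0 <= r -> 0 < Z0 -> (forall n, Cmod (zeta n) <= Z0) ->
  l2_le (diff (diff zeta)) S0 ->
  l2_le (gauged_nonlinearity mu q0 p zeta (fun _ => RtoC 0)) N0 ->
  ball_bounded (forcing kappa mu q0 p zeta) r
    (kappa * S0 + (N0 + lip_const mu q0 p Z0 r * r)).
Proof.
  intros Hk Hp Hr HZ0 HZ HS HN0 v Hv.
  apply (l2_le_ext (fun n => (RtoC kappa * Delta zeta n + gauged_nonlinearity mu q0 p zeta v n)%C)).
  { intros n. now rewrite forcing_split. }
  apply l2_le_plus; [|now apply (nonlinearity_ball_bounded mu q0 p zeta Z0)].
  apply (l2_le_dom _ (fun n => diff (diff zeta) (n + 1)%Z)); [exact Hk| |now apply l2_le_shift].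
  intros n. rewrite Delta_diff, Cmod_mult, Cmod_R, Rabs_pos_eq by exact Hk. lra.
Qed.

(* Duhamel's integral of [kappa Delta zeta] is evaluated exactly, as [U(t) zeta - zeta],
   which grows only like [sqrt t]. *)
Lemma duhamel_map_background kappa mu q0 p zeta phi0 phi t B K :
  0 <= kappa -> 0 <= t -> in_linf zeta -> in_l2 (diff (diff zeta)) ->
  (forall s, l2_le (gauged_nonlinearity mu q0 p zeta (phi s)) B) ->
  l2_Lipschitz (fun s => gauged_nonlinearity mu q0 p zeta (phi s)) K ->
  forall n, duhamel_map kappa (forcing kappa mu q0 p zeta) phi0 phi t n
  = (propagator kappa t phi0 n + ((propagator kappa t zeta n - zeta n)
     + Ci * duhamel_integral kappa (fun s => gauged_nonlinearity mu q0 p zeta (phi s)) t n))%C.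
Proof.
  intros Hk Ht Hz Hzz HB HK n. unfold duhamel_map. f_equal.
  pose proof (in_linf_Delta zeta Hz) as HDz.
  pose proof (is_CInt_reflect _ t _ (CInt_propagator kappa zeta n 0 t Hz)) as H1.
  cbv beta in H1. rewrite propagator_0 in H1.
  pose proof (duhamel_integral_exists kappa _ B K t 0 t n Hk (conj Ht (Rle_refl t)) HB HK) as H2.
  (* The integral of i kappa U(t-s) Delta zeta is U(t) zeta - zeta; the factor -i here is undone by
     the i in front of Duhamel's integral. *)
  assert (H3 : is_CInt (fun s => propagator kappa (t - s) (forcing kappa mu q0 p zeta (phi s)) n) 0 t
    ((- Ci) * (propagator kappa t zeta n - zeta n)
     + duhamel_integral kappa (fun s => gauged_nonlinearity mu q0 p zeta (phi s)) t n)%C).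
  { eapply is_CInt_ext; [exact Ht| |exact (is_CInt_plus _ _ _ _ _ _ (is_CInt_scal (- Ci)%C _ _ _ _ H1) H2)].
    intros s Hs. cbv beta.
    replace (forcing kappa mu q0 p zeta (phi s))
      with (fun m => (RtoC kappa * Delta zeta m + gauged_nonlinearity mu q0 p zeta (phi s) m)%C)
      by (apply functional_extensionality; intros m; now rewrite forcing_split).
    rewrite propagator_plus, (propagator_scal kappa (t - s) (RtoC kappa) (Delta zeta)).
    - assert (E : (Ci * Ci)%C = (- (1))%C) by (unfold Ci, Cmult, Copp, RtoC; simpl; f_equal; ring).
      transitivity (- (Ci * Ci) * (RtoC kappa * propagator kappa (t - s) (Delta zeta) n)
        + propagator kappa (t - s) (gauged_nonlinearity mu q0 p zeta (phi s)) n)%C; [ring|].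
      rewrite E. ring.
    - exact HDz.
    - now apply in_linf_scal.
    - exact (l2_le_linf _ _ (HB s)). }
  unfold duhamel_integral at 1. rewrite (is_CInt_CInt _ _ _ _ H3).
  assert (E : (Ci * Ci)%C = (- (1))%C) by (unfold Ci, Cmult, Copp, RtoC; simpl; f_equal; ring).
  set (X := duhamel_integral kappa (fun s => gauged_nonlinearity mu q0 p zeta (phi s)) t n).
  transitivity (- (Ci * Ci) * (propagator kappa t zeta n - zeta n) + Ci * X)%C; [ring|].
  rewrite E. ring.
Qed.

Lemma in_l2_diff u : in_l2 u -> in_l2 (diff u).
Proof. intros H. exact (proj1 (l2_le_in _ _ (l2_le_diff _ _ (in_l2_le _ H)))). Qed.

(** Otherwise [zeta] would vanish and the defect would be the constant -q0, which does not tend to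
    zero. Positivity supplies the strictly positive [M] that the Lipschitz bound on the powers asks
    for. *)
Lemma linf_norm_pos q0 zeta :
  0 < q0 -> in_linf zeta -> in_l2 (abs_defect q0 zeta) -> 0 < linf_norm zeta.
Proof.
  intros Hq Hz HD.
  destruct (Rlt_le_dec 0 (linf_norm zeta)) as [H|H]; [exact H|exfalso].
  destruct (l2_le_tends_to_zero _ _ (in_l2_le _ HD)) as [Hl _].
  assert (Hc : is_lim_seq (fun k => Cmod (abs_defect q0 zeta (Z.of_nat k))) q0).
  { apply (is_lim_seq_ext (fun _ => q0)); [|apply is_lim_seq_const].
    intros k. unfold abs_defect.
    pose proof (linf_norm_site zeta (Z.of_nat k) Hz).
    pose proof (Cmod_ge_0 (zeta (Z.of_nat k))).
    replace (Cmod (zeta (Z.of_nat k)) - q0) with (- q0) by lra.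
    now rewrite Cmod_R, Rabs_Ropp, Rabs_pos_eq by lra. }
  apply is_lim_seq_unique in Hl. apply is_lim_seq_unique in Hc.
  rewrite Hl in Hc. injection Hc. lra.
Qed.

Lemma rho_nonneg kappa mu q0 p zeta phi0 T :
  0 <= p -> 0 <= T -> 0 <= rho kappa mu q0 p zeta phi0 T.
Proof.
  intros Hp HT. unfold rho.
  apply Rmult_le_pos; [lra|].
  apply Rplus_le_le_0_compat; [apply Rplus_le_le_0_compat|].
  - apply sqrt_pos.
  - repeat apply Rmult_le_pos; apply sqrt_pos.
  - apply Rmult_le_pos; [|exact HT]. apply Rmult_le_pos; [apply Rabs_pos|].
    apply Rplus_le_le_0_compat; repeat apply Rmult_le_pos;
      auto using rpow_nonneg, sqrt_pos.
    apply sqrt_pos.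
Qed.

(** The factor 2 in the radius reserves one half of it for the datum, the background and the
    nonlinearity at zero; the variation of the nonlinearity over the ball takes the other half, as t
    L rho <= rho/2. *)
Lemma duhamel_map_ball kappa mu q0 p zeta phi0 T phi K t :
  0 < kappa -> 0 < q0 -> 1 <= p -> in_X1 zeta -> in_l2 (abs_defect q0 zeta) ->
  in_l2 phi0 -> 0 < T -> lifespan_condition kappa mu q0 p zeta phi0 T ->
  (forall s, l2_le (phi s) (rho kappa mu q0 p zeta phi0 T)) -> l2_Lipschitz phi K ->
  0 <= t <= T ->
  l2_le (duhamel_map kappa (forcing kappa mu q0 p zeta) phi0 phi t)
    (rho kappa mu q0 p zeta phi0 T).
Proof.
  intros Hk Hq Hp [Hz Hdz] HD H0 HT Hlife Hr HK Ht.
  pose proof (lifespan_lip_const _ _ _ _ _ _ _ Hp HT Hlife) as HLT.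
  assert (Hk' : 0 <= kappa) by lra.
  pose proof (in_l2_diff _ Hdz) as Hddz.
  pose proof (linf_norm_pos _ _ Hq Hz HD) as HZ0.
  pose proof (fun n => linf_norm_site zeta n Hz) as HZ.
  set (Z0 := linf_norm zeta) in *. set (r := rho kappa mu q0 p zeta phi0 T) in *.
  assert (Hr0 : 0 <= r) by (apply rho_nonneg; lra).
  set (L := lip_const mu q0 p Z0 r) in *.
  assert (HL : 0 <= L) by now apply lip_const_nonneg.
  set (A1 := rpow (Z0 + q0 + l2_norm (abs_defect q0 zeta)) (2 * p + 1)).
  set (S0 := l2_norm (diff (diff zeta))). set (Q := rpow q0 (2 * p)).
  set (N0 := Rabs mu * (2 * p * A1 + Q * S0)).
  assert (HN0 : l2_le (gauged_nonlinearity mu q0 p zeta (fun _ => RtoC 0)) N0)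
    by (apply nonlinearity_background_l2; auto using in_l2_le).
  assert (HG : forall s, l2_le (gauged_nonlinearity mu q0 p zeta (phi s)) (N0 + L * r)).
  { intros s. now apply (nonlinearity_ball_bounded mu q0 p zeta Z0 r N0). }
  assert (HGK : l2_Lipschitz (fun s => gauged_nonlinearity mu q0 p zeta (phi s)) (L * K)).
  { intros s s'. rewrite Rmult_assoc.
    apply (l2_le_ext (fun n => (forcing kappa mu q0 p zeta (phi s) n
      - forcing kappa mu q0 p zeta (phi s') n)%C)).
    { intros n. rewrite !forcing_split. ring. }
    apply forcing_ball_Lipschitz; auto. }
  apply (l2_le_ext _ _ _ (fun n => eq_sym (duhamel_map_background kappa mu q0 p zeta phi0 phi t
    (N0 + L * r) (L * K) Hk' (proj1 Ht) Hz Hddz HG HGK n))).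
  apply l2_le_weaken with (l2_norm phi0
    + (sqrt (2 * kappa) * l2_norm (diff zeta) * sqrt t + (t - 0) * (N0 + L * r))).
  - apply l2_le_plus; [apply propagator_l2_contraction; auto using in_l2_le; lra|].
    apply l2_le_plus; [apply propagator_background_l2; auto using in_l2_le; lra|].
    apply l2_le_scal_Ci.
    apply (duhamel_integral_l2 kappa (fun s => gauged_nonlinearity mu q0 p zeta (phi s))
      (N0 + L * r) t 0 t); auto; try lra.
    + exact (l2_le_pos _ _ (HG 0)).
    + intros n. apply (duhamel_integral_exists kappa _ (N0 + L * r) (L * K)); auto; lra.
  - assert (E1 : sqrt (2 * kappa) * l2_norm (diff zeta) * sqrt t
       <= sqrt (2 * kappa) * l2_norm (diff zeta) * sqrt T).
    { apply Rmult_le_compat_l; [apply Rmult_le_pos; apply sqrt_pos|].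
      apply sqrt_le_1_alt. lra. }
    assert (HA1 : 0 <= A1) by apply rpow_nonneg. assert (HQ : 0 <= Q) by apply rpow_nonneg.
    assert (HS0 : 0 <= S0) by apply sqrt_pos. pose proof (Rabs_pos mu) as Hmu.
    assert (E2 : t * N0 <= Rabs mu * (rpow 2 (2 * (p + 2)) * p * A1 + Q * S0) * T).
    { rewrite Rmult_comm. apply Rmult_le_compat; [| |unfold N0|lra].
      - exact (l2_le_pos _ _ HN0).
      - lra.
      - apply Rmult_le_compat_l; [exact Hmu|]. apply Rplus_le_compat_r.
        apply Rmult_le_compat_r; [exact HA1|]. apply Rmult_le_compat_r; [lra|].
        (* The nonlinearity at zero carries the factor 2 where the radius offers 2^(2(p+2)). *)
        rewrite rpow_pos_eq by lra.
        rewrite <- (Rpower_1 2) at 1 by lra. apply Rpower_2_ge. lra. }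
    assert (E3 : t * (L * r) <= r / 2).
    { assert (t * L <= / 2) by nra. nra. }
    assert (Er : r = 2 * (l2_norm phi0 + sqrt (2 * kappa) * l2_norm (diff zeta) * sqrt T
      + Rabs mu * (rpow 2 (2 * (p + 2)) * p * A1 + Q * S0) * T)) by reflexivity.
    rewrite Rminus_0_r, Rmult_plus_distr_l. lra.
Qed.

(** The radius depends on the datum, so both solutions are placed in the larger of the two balls.
    Its Lipschitz constant belongs to one of the two data, whose own lifespan condition bounds
    it. *)
Lemma ball_solution_stability kappa mu q0 p zeta phi0 psi0 T phi psi delta :
  0 < kappa -> 0 < q0 -> 1 <= p -> in_X1 zeta -> in_l2 (abs_defect q0 zeta) ->
  in_l2 phi0 -> in_l2 psi0 -> 0 < T ->
  lifespan_condition kappa mu q0 p zeta phi0 T ->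
  lifespan_condition kappa mu q0 p zeta psi0 T ->
  ball_solution kappa mu q0 p zeta phi0 T phi ->
  ball_solution kappa mu q0 p zeta psi0 T psi ->
  l2_le (fun n => (phi0 n - psi0 n)%C) delta ->
  forall t, 0 <= t <= T -> l2_le (fun n => (phi t n - psi t n)%C) (2 * delta).
Proof.
  intros Hk Hq Hp [Hz Hdz] HD H0 H0' HT Hl Hl' [Hphi [Dphi _]] [Hpsi [Dpsi _]] Hdelta.
  pose proof (lifespan_lip_const _ _ _ _ _ _ _ Hp HT Hl) as HL.
  pose proof (lifespan_lip_const _ _ _ _ _ _ _ Hp HT Hl') as HL'.
  pose proof (linf_norm_pos _ _ Hq Hz HD) as HZ0.
  pose proof (fun n => linf_norm_site zeta n Hz) as HZ.
  set (r1 := rho kappa mu q0 p zeta phi0 T) in *.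
  set (r2 := rho kappa mu q0 p zeta psi0 T) in *.
  assert (Hr0 : 0 <= Rmax r1 r2).
  { eapply Rle_trans; [|apply Rmax_l]. apply rho_nonneg; lra. }
  pose proof (nonlinearity_background_l2 mu q0 p zeta _ _ _ Hp Hq HZ (in_l2_le _ HD)
    (in_l2_le _ (in_l2_diff _ Hdz))) as HN0.
  eapply (duhamel_stability kappa T (Rmax r1 r2) (lip_const mu q0 p (linf_norm zeta) (Rmax r1 r2))
    _ (forcing kappa mu q0 p zeta) phi0 psi0 phi psi (Rmax (l2_norm phi0) (l2_norm psi0))).
  - lra.
  - now apply lip_const_nonneg.
  - unfold Rmax. destruct Rle_dec; assumption.
  - refine (forcing_ball_bounded kappa mu q0 p zeta _ _ _ _ _ Hp Hr0 HZ0 HZ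
      (in_l2_le _ (in_l2_diff _ Hdz)) HN0). lra.
  - now apply forcing_ball_Lipschitz.
  - eapply l2_le_weaken; [now apply in_l2_le|apply Rmax_l].
  - eapply l2_le_weaken; [now apply in_l2_le|apply Rmax_r].
  - exact Hdelta.
  - intros t Ht. eapply l2_le_weaken; [exact (in_closed_ball_l2_le _ _ _ _ Hphi Ht)|apply Rmax_l].
  - intros t Ht. eapply l2_le_weaken; [exact (in_closed_ball_l2_le _ _ _ _ Hpsi Ht)|apply Rmax_r].
  - exact Dphi.
  - exact Dpsi.
Qed.

Lemma ball_solution_exists kappa mu q0 p zeta phi0 T :
  0 < kappa -> 0 < q0 -> 1 <= p -> in_X1 zeta -> in_l2 (abs_defect q0 zeta) ->
  in_l2 phi0 -> 0 < T -> lifespan_condition kappa mu q0 p zeta phi0 T ->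
  exists phi, ball_solution kappa mu q0 p zeta phi0 T phi.
Proof.
  intros Hk Hq Hp HX HD H0 HT Hl. pose proof HX as [Hz Hdz].
  pose proof (lifespan_lip_const _ _ _ _ _ _ _ Hp HT Hl) as HL.
  pose proof (linf_norm_pos _ _ Hq Hz HD) as HZ0.
  pose proof (fun n => linf_norm_site zeta n Hz) as HZ.
  set (r := rho kappa mu q0 p zeta phi0 T) in *.
  assert (Hr0 : 0 <= r) by (apply rho_nonneg; lra).
  assert (Hk' : 0 <= kappa) by lra.
  pose proof (nonlinearity_background_l2 mu q0 p zeta _ _ _ Hp Hq HZ (in_l2_le _ HD)
    (in_l2_le _ (in_l2_diff _ Hdz))) as HN0.
  pose proof (forcing_ball_bounded kappa mu q0 p zeta _ _ _ _ Hk' Hp Hr0 HZ0 HZ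
      (in_l2_le _ (in_l2_diff _ Hdz)) HN0) as HB.
  pose proof (forcing_ball_Lipschitz kappa mu q0 p zeta _ _ Hp Hr0 HZ0 HZ) as HN.
  pose proof (lip_const_nonneg mu q0 p (linf_norm zeta) r Hp) as HL0.
  destruct (duhamel_fixed_point kappa T r _ _ _ phi0 _ Hk' (Rlt_le _ _ HT) HL0 HL Hr0 HB HN
    (in_l2_le _ H0)) as (phi & K & Hphi & HK & Heq).
  { intros phi K H1 H2 t Ht. now apply duhamel_map_ball with K. }
  exists phi. split; [split|].
  - exact (l2_Lipschitz_in_CT T phi r K Hphi HK).
  - apply CT_norm_le. auto.
  - split; [|split].
    + intros t n Ht.
      exists (duhamel_integral kappa (fun s => forcing kappa mu q0 p zeta (phi s)) t n).
      split; [|exact (Heq t n Ht)].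
      refine (duhamel_integral_exists kappa (fun s => forcing kappa mu q0 p zeta (phi s))
        _ (lip_const mu q0 p (linf_norm zeta) r * K) t 0 t n Hk' _ (fun s => HB _ (Hphi s)) _);
        [lra|].
      intros s s'. rewrite Rmult_assoc. apply HN; auto.
    + intros n. rewrite Heq by lra. unfold duhamel_map. rewrite propagator_0.
      assert (E : is_CInt (fun s => propagator kappa (0 - s) (forcing kappa mu q0 p zeta (phi s)) n) 0 0 (RtoC 0))
        by exact (is_RInt_point (V := C_R_NormedModule) _ 0).
      unfold duhamel_integral. rewrite (is_CInt_CInt _ _ _ _ E). ring.
    + intros t Ht. exact (l2_le_lim_at_infty _ _ (Hphi t)).
Qed.

Theorem theorem2p3 :
  forall (kappa mu q0 p : R) (zeta : Z -> C) (zeta_m zeta_p : C),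
    0 < kappa -> 0 < q0 -> 1 <= p ->
    in_X1 zeta ->
    lim_at_infty zeta zeta_m zeta_p ->
    Cmod zeta_m = q0 -> Cmod zeta_p = q0 ->
    in_l2 (abs_defect q0 zeta) ->
    (* existence and uniqueness *)
    (forall (phi0 : Z -> C) (T : R),
       in_l2 phi0 -> 0 < T ->
       lifespan_condition kappa mu q0 p zeta phi0 T ->
       (exists phi : R -> Z -> C, ball_solution kappa mu q0 p zeta phi0 T phi) /\
       (forall phi psi : R -> Z -> C,
          ball_solution kappa mu q0 p zeta phi0 T phi ->
          ball_solution kappa mu q0 p zeta phi0 T psi ->
          forall (t : R) (n : Z), 0 <= t <= T -> phi t n = psi t n)) /\
    (* continuity of the data-to-solution map into C([0,T]; l^2) *)
    (forall (phi0 : Z -> C) (T : R),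
       in_l2 phi0 -> 0 < T ->
       lifespan_condition kappa mu q0 p zeta phi0 T ->
       forall eps : R, 0 < eps ->
       exists delta : R, 0 < delta /\
       forall psi0 : Z -> C,
         in_l2 psi0 ->
         lifespan_condition kappa mu q0 p zeta psi0 T ->
         l2_norm (seq_minus psi0 phi0) < delta ->
         forall phi psi : R -> Z -> C,
           ball_solution kappa mu q0 p zeta phi0 T phi ->
           ball_solution kappa mu q0 p zeta psi0 T psi ->
           Rbar_lt (CT_norm T (CT_minus psi phi)) eps).
Proof.
  intros kappa mu q0 p zeta zeta_m zeta_p Hk Hq Hp HX _ _ _ HD. split.
  - intros phi0 T H0 HT Hl. split; [now apply ball_solution_exists|].
    intros phi psi Hphi Hpsi t n Ht.
    (* Uniqueness is stability for data at distance zero. *)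
    assert (Hz : l2_le (fun n => (phi0 n - phi0 n)%C) 0)
      by (apply (l2_le_ext (fun _ => RtoC 0)); [intros; ring|apply l2_le_zero]).
    pose proof (l2_le_site _ _ n (ball_solution_stability kappa mu q0 p zeta phi0 phi0 T phi psi 0
      Hk Hq Hp HX HD H0 H0 HT Hl Hl Hphi Hpsi Hz t Ht)) as H.
    cbv beta in H. pose proof (Cmod_ge_0 (phi t n - psi t n)).
    assert (E : (phi t n - psi t n)%C = RtoC 0) by (apply Cmod_eq_0; lra).
    replace (phi t n) with ((phi t n - psi t n) + psi t n)%C by ring. rewrite E. ring.
  (* Stability bounds the supremum only by 2 delta in the weak sense, so 2 delta must lie strictly
     below [eps]. *)
  - intros phi0 T H0 HT Hl eps Heps. exists (eps / 3). split; [lra|].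
    intros psi0 H0' Hl' Hd phi psi Hphi Hpsi.
    assert (Hin : in_l2 (seq_minus psi0 phi0))
      by exact (proj1 (l2_le_in _ _ (l2_le_minus _ _ _ _ (in_l2_le _ H0') (in_l2_le _ H0)))).
    apply Rbar_le_lt_trans with (2 * (eps / 3)); [|simpl; lra].
    apply CT_norm_le. intros t Ht.
    apply (ball_solution_stability kappa mu q0 p zeta psi0 phi0 T psi phi (eps / 3)); auto.
    apply l2_le_weaken with (l2_norm (seq_minus psi0 phi0)); [exact (in_l2_le _ Hin)|lra].
Qed.
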